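(* Let $(w,p,W)$ be a 0-1-Knapsack instance with $n$ items, weights $w \in \mathbb{N}^n$, profits $p \in \mathbb{N}^n$, budget $W \in \mathbb{N}$, and distinct profit-to-weight ratios $p_1/w_1 > \dots > p_n/w_n$. Let $w_{\max} = \max_i w_i$, let $g$ be the maximal prefix solution, and let $x^*$ be an arbitrary optimal solution. Given $w,p,W$, one can compute in time $\widetilde{O}(n)$ a partition $I_1 \cup \dots \cup I_k = [n]$ into $k = O(\log^2 n)$ parts and integers (proximity bounds) $\Delta_1,\dots,\Delta_k$ such that for each $1 \le j \le k$, $$\sum_{i \in I_j} w_i |g_i - x^*_i| \le \Delta_j \quad\text{and}\quad |\operatorname{supp}(w(I_j))| \cdot \Delta_j \le 300000000 \log^3(2n) \cdot w_{\max}^2.$$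
   Context: 0-1-Knapsack: given $p \in \mathbb{N}^n$, $w \in \mathbb{N}^n$, $W \in \mathbb{N}$, compute $\max\{p^T x : w^T x \le W,\ x \in \{0,1\}^n\}$; an optimal solution is a maximizer $x^*$. With items ordered by non-increasing profit-to-weight ratio, the maximal prefix solution $g \in \{0,1\}^n$ is defined by letting $t \in [n+1]$ be maximal with $w_1 + \dots + w_{t-1} \le W$ and setting $g_i = 1$ for $i < t$ and $g_i = 0$ for $i \ge t$. For $I \subseteq [n]$, $w(I)$ denotes the multi-set $\{w_i : i \in I\}$ and $\operatorname{supp}(w(I))$ the set of distinct weights among items of $I$. $\widetilde{O}(T) = \bigcup_{c\ge0} O(T\log^c T)$. *)

(* Defs.v *)
From HB Require Import structures.
From mathcomp Require Import all_boot all_order all_algebra.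
From mathcomp Require Import reals exp.

Set Implicit Arguments.
Unset Strict Implicit.
Unset Printing Implicit Defensive.

Import Order.TTheory GRing.Theory Num.Theory.

Definition log2 (R : realType) (x : R) : R := (ln x / ln 2)%R.

(** * 0-1-Knapsack *)

Section Knapsack.
Variables (n : nat) (w p : 'I_n -> nat) (W : nat).
Implicit Types x y : {ffun 'I_n -> bool}.

Definition weight x : nat := \sum_i w i * x i.
Definition profit x : nat := \sum_i p i * x i.

Definition optimal x : Prop :=
  weight x <= W /\ forall y, weight y <= W -> profit y <= profit x.

Definition max_weight : nat := \max_i w i.

(* The number t - 1 of items taken, where t in [n+1] is maximal with
   w_1 + ... + w_(t-1) <= W. The value 0 always qualifies. *)
Definition prefix_length : nat :=
  \max_(m < n.+1 | \sum_(i < n | i < m) w i <= W) m.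

Definition max_prefix : {ffun 'I_n -> bool} :=
  [ffun i : 'I_n => i < prefix_length].

Definition supp_weights (I : {set 'I_n}) : seq nat :=
  undup [seq w i | i in I].

End Knapsack.

(** * A word RAM

  Programs are finite syntactic objects. The memory consists of registers and
  arrays of natural numbers; each program can only mention finitely many of
  them, since their names are literals (an array index, in contrast, is
  computed). All cells that do not hold the input are initially 0. *)

Inductive binop := Add | Sub | Mul | Div | Lt | Eq.

Inductive expr :=
  | Const of nat
  | Reg of nat
  | Read of nat & expr            (* array name, index *)
  | Bin of binop & expr & expr.

Inductive cmd :=
  | Skip
  | Assign of nat & expr          (* register, value *)
  | Write of nat & expr & expr    (* array name, index, value *)
  | Seq of cmd & cmd
  | If of expr & cmd & cmd
  | While of expr & cmd.

Record state := State { reg : nat -> nat; arr : nat -> nat -> nat }.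

Definition set_reg (s : state) (r v : nat) : state :=
  State (fun r' => if r' == r then v else reg s r') (arr s).

Definition set_arr (s : state) (a i v : nat) : state :=
  State (reg s)
    (fun a' i' => if (a' == a) && (i' == i) then v else arr s a' i').

(* Subtraction is truncated, division is rounded down, and m %/ 0 = 0. *)
Definition eval_binop (o : binop) (x y : nat) : nat :=
  match o with
  | Add => x + y
  | Sub => x - y
  | Mul => x * y
  | Div => x %/ y
  | Lt => x < y
  | Eq => x == y
  end.

Fixpoint eval (s : state) (e : expr) : nat :=
  match e with
  | Const v => v
  | Reg r => reg s r
  | Read a i => arr s a (eval s i)
  | Bin o e1 e2 => eval_binop o (eval s e1) (eval s e2)
  end.

(* Unit cost for every constant, memory access and operation. *)
Fixpoint cost (e : expr) : nat :=
  match e with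
  | Const _ | Reg _ => 1
  | Read _ i => (cost i).+1
  | Bin _ e1 e2 => (cost e1 + cost e2).+1
  end.

(* Every value that occurs in the evaluation of e, array indices included,
   fits into a machine word, i.e. is smaller than M. *)
Fixpoint fits (M : nat) (s : state) (e : expr) : bool :=
  (eval s e < M) &&
  match e with
  | Const _ | Reg _ => true
  | Read _ i => fits M s i
  | Bin _ e1 e2 => fits M s e1 && fits M s e2
  end.

(* exec M c s t s' : started in s, the program c halts in s' after t steps.
   A computation that produces a value >= M is stuck: it has no derivation. *)
Inductive exec (M : nat) : cmd -> state -> nat -> state -> Prop :=
  | ExecSkip s : exec M Skip s 1 s
  | ExecAssign s r e :
      fits M s e ->
      exec M (Assign r e) s (cost e).+1 (set_reg s r (eval s e))
  | ExecWrite s a i e :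
      fits M s i -> fits M s e ->
      exec M (Write a i e) s (cost i + cost e).+1
        (set_arr s a (eval s i) (eval s e))
  | ExecSeq c1 c2 s s1 s2 t1 t2 :
      exec M c1 s t1 s1 -> exec M c2 s1 t2 s2 ->
      exec M (Seq c1 c2) s (t1 + t2) s2
  | ExecIfTrue e c1 c2 s s' t :
      fits M s e -> eval s e != 0 -> exec M c1 s t s' ->
      exec M (If e c1 c2) s (cost e + t).+1 s'
  | ExecIfFalse e c1 c2 s s' t :
      fits M s e -> eval s e = 0 -> exec M c2 s t s' ->
      exec M (If e c1 c2) s (cost e + t).+1 s'
  | ExecWhileTrue e c s s1 s2 t1 t2 :
      fits M s e -> eval s e != 0 ->
      exec M c s t1 s1 -> exec M (While e c) s1 t2 s2 ->
      exec M (While e c) s (cost e + t1 + t2).+1 s2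
  | ExecWhileFalse e c s :
      fits M s e -> eval s e = 0 ->
      exec M (While e c) s (cost e).+1 s.

(** * Encoding of instances and of solutions *)

(* Registers 0 and 1 hold n and W, arrays 0 and 1 hold w and p. *)
Definition input_state n (w p : 'I_n -> nat) (W : nat) : state :=
  State
    (fun r => match r with 0 => n | 1 => W | _ => 0 end)
    (fun a i => match a with
                | 0 => oapp w 0 (insub i)
                | 1 => oapp p 0 (insub i)
                | _ => 0
                end).

(* A word holds d * log2 (n + W + max w + max p + 2) bits, i.e. a constant
   number of input numbers or array indices. *)
Definition word_bound (d n : nat) (w p : 'I_n -> nat) (W : nat) : nat :=
  (n + W + \max_i w i + \max_i p i + 2) ^ d.

(* Register 2 holds k, entry i of array 2 is the number j of the part I_j that
   contains item i, and entry j of array 3 is Delta_j. *)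
Definition outputs n k (s : state) (I : 'I_k -> {set 'I_n})
    (Delta : 'I_k -> nat) : Prop :=
  [/\ reg s 2 = k,
      forall (i : 'I_n) (j : 'I_k), (i \in I j) = (arr s 2 i == j) &
      forall j : 'I_k, arr s 3 j = Delta j].

(* Main.v *)
Require Import Defs.
From HB Require Import structures.
From mathcomp Require Import all_boot all_order all_algebra.
From mathcomp Require Import reals exp.
From mathcomp Require Import zify ring.

Set Implicit Arguments.
Unset Strict Implicit.
Unset Printing Implicit Defensive.

Import Order.TTheory GRing.Theory Num.Theory.

(**
  Exchanging items of equal total weight, dropped ones for chosen ones of smaller
  ratio, improves a solution. So it suffices to show that two multi-sets of weights
  at most M have a common subset sum as soon as one of them contains s distinct
  values m times each, with s^2 m >> M, and the other one has sum >> M^2 / s.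

  For this, the first multi-set is shown to have a long homogeneous arithmetic
  progression of subset sums. Pairs of values at distance O(M/s) form a multi-set
  of differences that is dense in [1, O(M/s)]; by induction on M it has a
  progression of some difference d. Further pairs either are not congruent modulo
  d, and then d - 1 of them reduce d to a proper divisor, or they are congruent and
  prolong the progression. Any d elements of the second multi-set have a nonempty
  subset whose sum is a multiple of d, so its subset sums hit the progression.

  Walk from the break item outwards, on either side. An item that is the c-th copy
  of its weight has level floor (log c); an item of level r belongs to the class
  (side, r, q) if at its time between 2^q and 2^(q+1) - 1 weights have reached
  level r. When a class starts, at least 2^q weights have 2^r copies closer to the
  break item. Half of them are mostly chosen or mostly not chosen by the optimal
  solution; one alternative is compared with the items of the class, which are
  farther away, and the other one with the changed items on the other side.
*)

(** * Arithmetic progressions of subset sums *)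

Definition subsum (D : seq nat) (x : nat) : Prop :=
  exists E F, perm_eq D (E ++ F) /\ sumn E = x.

Definition has_AP (D : seq nat) (x d l : nat) : Prop :=
  forall j, j <= l -> subsum D (x + d * j).

Lemma perm_sumn (s t : seq nat) : perm_eq s t -> sumn s = sumn t.
Proof. by move=> st; rewrite !sumnE; apply: perm_big. Qed.

Lemma subsum0 D : subsum D 0.
Proof. by exists [::], D. Qed.

Lemma subsum_perm D D' x : perm_eq D D' -> subsum D x -> subsum D' x.
Proof.
move=> DD' [E [F [DEF Ex]]]; exists E, F; split=> //.
by rewrite -(permPl DD').
Qed.

Lemma subsum_cat D D' x y :
  subsum D x -> subsum D' y -> subsum (D ++ D') (x + y).
Proof.
move=> [E [F [DEF <-]]] [E' [F' [DEF' <-]]].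
exists (E ++ E'), (F ++ F'); rewrite sumn_cat; split=> //.
by apply: (perm_trans (perm_cat DEF DEF')); rewrite perm_catACA.
Qed.

Lemma subsum_catl D D' x : subsum D x -> subsum (D ++ D') x.
Proof. by move=> Dx; rewrite -[x]addn0; apply: subsum_cat (subsum0 _). Qed.

Lemma subsum_le D x : subsum D x -> x <= sumn D.
Proof.
by move=> [E [F [/perm_sumn-> <-]]]; rewrite sumn_cat leq_addr.
Qed.

Lemma sumn_le_size (D : seq nat) M :
  (forall v, v \in D -> v <= M) -> sumn D <= size D * M.
Proof.
elim: D => //= a D IH h; rewrite mulSn leq_add ?h ?mem_head //.
by apply: IH => v vD; apply: h; rewrite inE vD orbT.
Qed.

Lemma dvdn_sumn d (D : seq nat) :
  (forall v, v \in D -> d %| v) -> d %| sumn D.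
Proof. by rewrite sumnE big_seq => h; apply: dvdn_sum. Qed.

Lemma subsum_dvd d (D : seq nat) x :
  (forall v, v \in D -> d %| v) -> subsum D x -> d %| x.
Proof.
move=> h [E [F [/perm_mem DEF <-]]]; apply: dvdn_sumn => v vE.
by apply: h; rewrite DEF mem_cat vE.
Qed.

Lemma has_AP_perm D D' x d l : perm_eq D D' -> has_AP D x d l -> has_AP D' x d l.
Proof. by move=> DD' h j jl; apply: subsum_perm DD' _; apply: h. Qed.

(** With [a] the old progression is shifted by [a], with [a'] it comes [u] steps later; the two
    leave no gap because [u <= l.+1]. *)
Lemma has_AP_grow D x d l a a' u :
  has_AP D x d l -> a' = a + d * u -> u <= l.+1 ->
  has_AP (D ++ [:: a; a']) (x + a) d (l + u).
Proof.
move=> h a'E ul j jl; have [jl'|lj] := leqP j l.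
  rewrite addnAC; apply: subsum_cat; first exact: h.
  by exists [:: a], [:: a']; rewrite /= addn0.
have -> : x + a + d * j = (x + d * (j - u)) + a'.
  by rewrite a'E mulnBr; nia.
apply: subsum_cat; first by apply: h; lia.
exists [:: a'], [:: a]; rewrite /= addn0; split=> //.
by apply/permPl/(perm_catC [:: a] [:: a']).
Qed.

(* The residues of the subset sums grow with every summand delta until they are
   stable under adding delta, and then they contain a subgroup. *)
Lemma subsum_residues d (E : seq nat) :
  0 < d -> all (fun e => ~~ (d %| e)) E ->
  (exists d', [/\ d' %| d, d' < d &
     forall z, d' %| z -> exists2 y, subsum E y & y = z %[mod d]]) \/
  (exists T : seq nat, [/\ uniq T, size T = (size E).+1, 0 \in T &
     forall r, r \in T -> r < d /\ exists2 y, subsum E y & y %% d = r]).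
Proof.
move=> d0; elim: E => [_|e E IH /= /andP[de dE]].
  right; exists [:: 0]; split=> // r; rewrite inE => /eqP->.
  by split=> //; exists 0; rewrite ?mod0n //; apply: subsum0.
have sub y : subsum E y -> subsum (e :: E) y.
  move=> Ey; apply: (@subsum_perm (E ++ [:: e])); last exact: subsum_catl.
  by rewrite perm_catC.
have subD y : subsum E y -> subsum (e :: E) (y + e).
  move=> Ey; rewrite addnC; apply: (@subsum_cat [:: e]) => //.
  by exists [:: e], [::]; rewrite /= addn0.
case: (IH dE) => [[d' [d'd d'lt h]]|[T [uT sT T0 hT]]].
  by left; exists d'; split=> // z /h [y /sub]; exists y.
have [/allP Tst|] := boolP (all (fun r => (r + e) %% d \in T) T); last first.
  case/allPn=> r rT rT'; right; exists ((r + e) %% d :: T).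
  split; rewrite /= ?rT' ?sT ?inE ?T0 ?orbT //.
  move=> q; rewrite inE => /predU1P[->|/hT[qd [y Ey yq]]]; last first.
    by split=> //; exists y; first exact: sub.
  rewrite ltn_mod; split=> //.
  by have [rd [y /subD Ey yr]] := hT _ rT; exists (y + e); rewrite // -modnDml yr.
left; have e0 : 0 < e by case: (e) de => //; rewrite dvdn0.
have Tk k : (k * e) %% d \in T.
  elim: k => [|k IHk]; first by rewrite mod0n.
  by rewrite mulSnr -modnDml; apply: Tst.
(* The residues contain all multiples of [e], that is the subgroup generated by [gcdn d e], a proper
   divisor of [d] because [d] does not divide [e]. *)
exists (gcdn d e); split; first exact: dvdn_gcdl.
  rewrite ltn_neqAle dvdn_leq ?dvdn_gcdl // andbT.
  by apply: contra de => /eqP <-; apply: dvdn_gcdr.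
move=> z; rewrite gcdnC => /dvdnP[q ->].
have [a b ab _] := egcdnP d e0; have [_ [y /sub Ey yE]] := hT _ (Tk (q * a)).
exists y => //; rewrite yE -mulnA ab mulnDr.
by rewrite mulnA modnMDl.
Qed.

(** With [d - 1] summands the second alternative provides all [d] residues, and then [d' = 1]. *)
Lemma subsum_subgroup d (E : seq nat) :
  1 < d -> all (fun e => ~~ (d %| e)) E -> (size E).+1 = d ->
  exists d', [/\ d' %| d, d' < d &
     forall z, d' %| z -> exists2 y, subsum E y & y = z %[mod d]].
Proof.
move=> d1 dE sE; have d0 := ltnW d1.
case: (subsum_residues d0 dE) => // [[T [uT sT _ hT]]].
exists 1; split=> // z _.
have Td : T =i iota 0 d.
  case: (uniq_min_size uT (s2 := iota 0 d)) => //.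
    by move=> r /hT[rd _]; rewrite mem_iota.
  by rewrite size_iota sT sE.
have /hT[_ [y Ey yz]] : z %% d \in T by rewrite Td mem_iota ltn_mod.
by exists y.
Qed.

(* The summands in [E] come from the differences [delta], shifted by [c]. *)
Lemma has_AP_reduce D E delta c x d l Q :
  1 < d -> (size delta).+1 = d -> all (fun e => ~~ (d %| e)) delta ->
  (forall e, e \in delta -> e <= Q) -> 2 * Q <= l ->
  (forall y, subsum delta y -> subsum E (c + y)) ->
  has_AP D x d l ->
  exists d' x', [/\ d' %| d, 0 < d', d' < d & has_AP (D ++ E) x' d' l].
Proof.
move=> d1 sd dd dQ Ql hE hD; have [d' [d'd d'lt hd']] := subsum_subgroup d1 dd sd.
have d'0 : 0 < d' by case: (d') d'd => //; rewrite dvd0n; lia.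
(* No subset sum of [delta] exceeds the shift [d * Q], so the number [k] of steps [d] is not
   negative; [2 * d' <= d] and [2 * Q <= l] keep it at most [l]. *)
exists d', (x + c + d * Q); split=> // j jl.
have [|y Ey yz] := hd' (d * Q + d' * j).
  by rewrite dvdn_add ?dvdn_mulr.
have yle : y <= d * Q.
  apply: leq_trans (subsum_le Ey) _; apply: leq_trans (sumn_le_size dQ) _.
  by rewrite leq_mul2r; lia.
move: (eqP (introT eqP yz)); move/eqP; rewrite eq_sym eqn_mod_dvd; last by lia.
case/dvdnP=> k kE; rewrite mulnC in kE.
have zE : d * Q + d' * j = d * k + y by lia.
have -> : x + c + d * Q + d' * j = (x + d * k) + (c + y) by lia.
apply: subsum_cat; last exact: hE.
apply: hD; rewrite -(leq_pmul2l (ltnW d1)).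
have d'2 : 2 * d' <= d.
  case/dvdnP: d'd d'lt => -[|[|q]] ->; rewrite ?mul1n ?ltnn ?mul0n //.
  by rewrite leq_mul2r; lia.
have : d' * j <= d' * l by rewrite leq_mul2l jl orbT.
have : 2 * d' * l <= d * l by rewrite leq_mul2r d'2 orbT.
have : d * (2 * Q) <= d * l by rewrite leq_mul2l Ql orbT.
nia.
Qed.

Lemma subsum_cons e D y :
  subsum (e :: D) y -> subsum D y \/ exists2 y', subsum D y' & y = e + y'.
Proof.
case=> E [F [DEF <-]].
have : e \in E ++ F by rewrite -(perm_mem DEF) mem_head.
rewrite mem_cat => /orP[eE|eF].
  right; exists (sumn (rem e E)); last by rewrite (perm_sumn (perm_to_rem eE)).
  exists (rem e E), F; split=> //; rewrite -(perm_cons e).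
  apply: (perm_trans DEF); rewrite -cat_cons perm_cat2r.
  exact: perm_to_rem.
left; exists E, (rem e F); split=> //; rewrite -(perm_cons e).
apply: (perm_trans DEF); rewrite perm_sym -cat1s perm_catCA perm_cat2l perm_sym.
exact: perm_to_rem.
Qed.

(** * Extraction of pairs and spread of values *)

Definition unpair (P : seq (nat * nat)) : seq nat :=
  flatten [seq [:: p.1; p.2] | p <- P].

Lemma size_unpair P : size (unpair P) = 2 * size P.
Proof. by elim: P => //= p P; rewrite mulnS => ->. Qed.

(** One element of every pair is always taken; taking the larger one adds the difference of the
    pair. *)
Lemma subsum_unpair P y :
  all (fun p => p.1 <= p.2) P -> subsum [seq p.2 - p.1 | p <- P] y ->
  subsum (unpair P) (sumn [seq p.1 | p <- P] + y).
Proof.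
elim: P y => [|p P IH] y; first by move=> _ /subsum_le; rewrite leqn0 => /eqP->; apply: subsum0.
case/andP=> /= pp PP /subsum_cons[/(IH _ PP) hy|[y' /(IH _ PP) hy ->]].
  rewrite -addnA; apply: (@subsum_cat [:: p.1; p.2]) hy.
  by exists [:: p.1], [:: p.2]; rewrite /= addn0.
have -> : p.1 + sumn [seq q.1 | q <- P] + (p.2 - p.1 + y') =
  p.2 + (sumn [seq q.1 | q <- P] + y') by lia.
apply: (@subsum_cat [:: p.1; p.2]) hy.
by exists [:: p.2], [:: p.1]; rewrite /= addn0; split=> //; apply/permPl/(perm_catC [:: _] [:: _]).
Qed.

Lemma perm_to_rem2 (F : seq nat) a b :
  a \in F -> b \in F -> a != b -> perm_eq F (a :: b :: rem b (rem a F)).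
Proof.
move=> aF bF ab; apply: (perm_trans (perm_to_rem aF)); rewrite perm_cons.
apply: perm_to_rem; move: bF; rewrite (perm_mem (perm_to_rem aF)) inE.
by rewrite eq_sym (negPf ab).
Qed.

(** Related elements are removed greedily, two at a time. Irreflexivity makes them different, so
    that both can be removed. *)
Lemma extract_pairs (R : rel nat) k (F : seq nat) :
  (forall a, ~~ R a a) ->
  (exists P F', [/\ size P = k, all (fun p => R p.1 p.2) P &
     perm_eq F (unpair P ++ F')]) \/
  (exists G F', [/\ size G < 2 * k, perm_eq F (G ++ F') &
     forall a b, a \in F' -> b \in F' -> ~~ R a b]).
Proof.
move=> Rirr; elim: k F => [|k IH] F; first by left; exists [::], F.
have [/hasP[a aF /hasP[b bF Rab]]|noR] := boolP (has (fun a => has (R a) F) F).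
  have ab : a != b by apply: contraTneq Rab => ->; apply: Rirr.
  have FE := perm_to_rem2 aF bF ab.
  case: (IH (rem b (rem a F))) => [[P [F' [sP PR PF]]]|[G [F' [sG GF noR]]]].
    left; exists ((a, b) :: P), F'; rewrite /= sP Rab PR; split=> //.
    by apply: (perm_trans FE); rewrite !perm_cons.
  right; exists [:: a, b & G], F'; split=> //=; first by rewrite mulnS.
  by apply: (perm_trans FE); rewrite !perm_cons.
right; exists [::], F; split=> //= a b aF bF; apply: contra noR => Rab.
by apply/hasP; exists a => //; apply/hasP; exists b.
Qed.

Lemma sum_count_le (V U : seq nat) :
  uniq V -> \sum_(v <- V) count_mem v U <= size U.
Proof.
move=> uV; elim: U => [|a U IH]; first by rewrite big1.
rewrite (eq_bigr (fun v => (a == v) + count_mem v U)) // big_split /=.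
rewrite -add1n leq_add // (eq_bigr (fun v => if v == a then 1 else 0)).
  by rewrite -big_mkcond sum1_count count_uniq_mem // leq_b1.
by move=> v _; rewrite eq_sym; case: eqP.
Qed.

(** All copies of a value missing in [F], at least [m] of them, have been consumed by [U]. *)
Lemma size_exhausted (V D U F : seq nat) m :
  uniq V -> (forall v, v \in V -> m <= count_mem v D) -> perm_eq D (U ++ F) ->
  m * size [seq v <- V | v \notin F] <= size U.
Proof.
move=> uV hm DUF; apply: leq_trans (sum_count_le U (filter_uniq _ uV)).
rewrite mulnC -sum1_size big_distrl /= big_seq [leqRHS]big_seq.
apply: leq_sum => v; rewrite mem_filter => /andP[vF vV].
rewrite mul1n; apply: leq_trans (hm v vV) _.
by rewrite (permP DUF) count_cat (count_memPn vF) addn0.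
Qed.

Lemma pigeonhole_count (T : Type) (f : T -> nat) k (s : seq T) :
  0 < k -> all (fun x => f x < k) s ->
  exists2 b, b < k & size s <= k * count (fun x => f x == b) s.
Proof.
move=> k0 fk.
have sE : size s = \sum_(b < k) count (fun x => f x == b) s.
  elim: s fk => [|x s IH] /=; first by rewrite big1.
  case/andP=> xk /IH ->; rewrite big_split /= -add1n; congr (_ + _).
  rewrite (bigD1 (Ordinal xk)) //= eqxx big1 // => i.
  by rewrite -val_eqE eq_sym /= => /negPf->.
case: (pickP (fun b : 'I_k => size s <= k * count (fun x => f x == b) s)).
  by move=> b hb; exists b.
move=> h; exfalso.
have : \sum_(b < k) (1 + k * count (fun x => f x == b) s) <= \sum_(b < k) size s.
  by apply: leq_sum => b _; rewrite add1n ltnNge h.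
rewrite big_split /= -big_distrr /= -sE sum1_card sum_nat_const card_ord.
by rewrite -[leqRHS]add0n leq_add2r leqNgt k0.
Qed.

(** Take the minimum and the maximum: the distances from the minimum, divided by [d], are distinct
    and at most [u]. *)
Lemma congruent_spread (V : seq nat) d :
  uniq V -> 0 < size V -> 0 < d ->
  {in V &, forall a b, a < b -> d %| b - a} ->
  exists a u, [/\ a \in V, a + d * u \in V & size V <= u.+1].
Proof.
move=> uV sV d0 hd.
have exV : exists v, v \in V by case: (V) sV => // v W _; exists v; apply: mem_head.
have bV v : v \in V -> v <= sumn V.
  by move=> vV; rewrite (perm_sumn (perm_to_rem vV)) /= leq_addr.
case: (ex_minnP exV) => a aV amin; case: (ex_maxnP exV bV) => b bV' bmax.
have dv v : v \in V -> d %| v - a.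
  move=> vV; have := amin v vV; rewrite leq_eqVlt => /predU1P[<-|av].
    by rewrite subnn dvdn0.
  exact: hd.
exists a, ((b - a) %/ d); rewrite mulnC divnK ?dv // subnKC ?amin //; split=> //.
rewrite -[X in _ <= X](size_iota 0) -(size_map (fun v => (v - a) %/ d)).
apply: uniq_leq_size.
  rewrite map_inj_in_uniq // => v w vV wV /(congr1 (muln^~ d)).
  by rewrite !divnK ?dv //; have := amin v vV; have := amin w wV; lia.
move=> _ /mapP[v vV ->]; rewrite mem_iota /= add0n ltnS leq_div2r //.
exact/leq_sub2r/bmax.
Qed.

(** Among the intervals of length [Q] that cover [[0, M]] one contains an average share of [V]; its
    values are pairwise congruent modulo [d]. *)
Lemma block_spread (V : seq nat) M Q d :
  uniq V -> 0 < size V -> (forall v, v \in V -> v <= M) -> 0 < Q -> 0 < d ->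
  {in V &, forall a b, a < b -> b - a <= Q -> d %| b - a} ->
  exists a u, [/\ a \in V, a + d * u \in V, d * u <= Q &
    size V <= (M %/ Q).+1 * u.+1].
Proof.
move=> uV sV VM Q0 d0 hd.
have [|c _ hc] := @pigeonhole_count _ (fun v => v %/ Q) (M %/ Q).+1 V isT.
  by apply/allP=> v vV; rewrite ltnS leq_div2r ?VM.
set B := [seq v <- V | v %/ Q == c].
have BV : {subset B <= V} by move=> v; rewrite mem_filter => /andP[].
have BQ v : v \in B -> v %/ Q = c by rewrite mem_filter => /andP[/eqP].
have bQ v w : v \in B -> w \in B -> v - w <= Q.
  move=> /BQ vc /BQ wc; rewrite (divn_eq v Q) (divn_eq w Q) vc wc subnDl.
  by have := ltn_pmod v Q0; lia.
rewrite -size_filter -/B in hc.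
have [||a [u [aB auB su]]] := @congruent_spread B d (filter_uniq _ uV) _ d0.
- by rewrite lt0n; apply: contraTneq hc => ->; rewrite muln0 -ltnNge.
- by move=> a b aB bB ab; apply: hd; rewrite ?BV // bQ.
exists a, u; rewrite !BV //; split=> //; first by have := bQ _ _ auB aB; rewrite addKn.
by apply: leq_trans hc _; rewrite leq_mul2l su orbT.
Qed.

(** * Prolonging a progression of subset sums *)

Section Climb.

(* The values [V] occur at least [m] times each in [D]; at most [m * Z] elements
   of [D] get used, so that all but [Z] values remain available. *)
Variables (V D : seq nat) (M m Z : nat).
Hypotheses (uV : uniq V) (M0 : 0 < M) (m0 : 0 < m).
Hypothesis VM : forall v, v \in V -> v <= M.
Hypothesis Vm : forall v, v \in V -> m <= count_mem v D.
Hypotheses (Z4 : 4 * Z <= size V) (V2 : 2 <= size V).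

(** [U] is the consumed part of [D], which carries the progression, and [F] is what is left. *)
Definition partial_AP (U F : seq nat) (x d l : nat) : Prop :=
  perm_eq D (U ++ F) /\ has_AP U x d l.

Lemma size_available (U F : seq nat) : perm_eq D (U ++ F) -> size U <= m * Z ->
  size V <= size [seq v <- V | v \in F] + Z.
Proof.
move=> /(size_exhausted uV Vm) h hU; have := leq_trans h hU.
rewrite leq_pmul2l // => h'; rewrite -(count_predC (mem F) V) -!size_filter.
by rewrite leq_add2l.
Qed.

(** At least three quarters of the values are left because [4 * Z <= size V]; [block_spread] applies
    to them. *)
Lemma block_available (U F : seq nat) Q d :
  perm_eq D (U ++ F) -> size U <= m * Z -> 0 < Q -> 0 < d ->
  {in F &, forall a b, a < b -> b - a <= Q -> d %| b - a} ->
  exists a u, [/\ a \in F, a + d * u \in F, d * u <= Q &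
    3 * size V <= 4 * ((M %/ Q).+1 * u.+1)].
Proof.
move=> DUF hU Q0 d0 hF; have hs := size_available DUF hU.
have FV v : v \in [seq v <- V | v \in F] -> v \in F /\ v \in V.
  by rewrite mem_filter => /andP[].
have hs0 : 0 < size [seq v <- V | v \in F] by lia.
have hM v : v \in [seq v <- V | v \in F] -> v <= M by case/FV=> _ /VM.
have hd : {in [seq v <- V | v \in F] &, forall a b, a < b -> b - a <= Q -> d %| b - a}.
  by move=> a b /FV[aF _] /FV[bF _]; apply: hF.
have [a [u [/FV[aF _] /FV[auF _] uQ su]]] :=
  block_spread (filter_uniq _ uV) hs0 hM Q0 d0 hd.
exists a, u; split=> //; move: su hs Z4; clear; set X := _ * _; move: X (size V) (size _).
lia.
Qed.

(** [G] is set aside only for the choice of a pair, so that close values in [F'] are congruent;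
    afterwards it is available again. The pair prolongs the progression by at least a fraction of
    order [size V / M] of its length. *)
Lemma partial_AP_grow U G F F' x d l Q :
  partial_AP U F x d l -> perm_eq F (G ++ F') -> size U + size G <= m * Z ->
  0 < d -> Q <= M -> 2 * Q <= l -> l <= 2 * Q + 1 -> 8 * M <= size V * Q ->
  {in F' &, forall a b, a < b -> b - a <= Q -> d %| b - a} ->
  exists U' F'' x' u, [/\ partial_AP U' F'' x' d (l + u), size U' = size U + 2 &
     size V * l <= 12 * M * u].
Proof.
move=> [DUF hAP] FGF hU d0 QM Ql lQ VQ hF.
have Q0 : 0 < Q by case: (Q) VQ => //; rewrite muln0; lia.
have [||a [u [aF auF uQ su]]] := @block_available (U ++ G) F' Q d _ _ Q0 d0 hF.
- by rewrite -catA; apply: (perm_trans DUF); rewrite perm_cat2l.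
- by rewrite size_cat.
have hQ : Q * (M %/ Q).+1 <= 2 * M by rewrite mulnS mulnC; have := leq_divM M Q; lia.
have sQ : 3 * size V * Q <= 8 * M * u.+1.
  have := leq_mul (leqnn Q) su; have := leq_mul hQ (leqnn u.+1); lia.
(* From [u >= 2] follows [2 * u.+1 <= 3 * u], which turns the factor 8 into 12; moreover the two
   elements of the pair differ. *)
have u2 : 2 <= u.
  rewrite ltnNge; apply/negP => u1.
  have : 8 * M * u.+1 <= 8 * M * 2 by rewrite leq_mul2l; lia.
  by lia.
have sl : size V * l <= size V * (3 * Q) by rewrite leq_mul2l; lia.
have aau : a != a + d * u by rewrite -[X in X != _]addn0 eqn_add2l; nia.
exists (U ++ [:: a; a + d * u]), (G ++ rem (a + d * u) (rem a F')), (x + a), u.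
split; last 2 first.
- by rewrite size_cat.
- by have : 8 * M * 2 <= 8 * M * u; [rewrite leq_mul2l u2 orbT | lia].
split.
  apply: (perm_trans DUF); rewrite -catA perm_cat2l; apply: (perm_trans FGF).
  rewrite perm_sym perm_catCA perm_cat2l perm_sym.
  exact: perm_to_rem2.
apply: has_AP_grow hAP _ _ => //.
by have : 1 * u <= d * u; [rewrite leq_mul2r d0 orbT | lia].
Qed.

(** If there are [d - 1] disjoint close pairs that are incongruent modulo [d], their differences
    reduce [d] at least by half. Otherwise fewer pairs exhaust all incongruence, and the rest
    prolongs the progression. *)
Lemma partial_AP_step U F x d l :
  partial_AP U F x d l -> 0 < d -> l < 2 * M -> 24 * M <= size V * l ->
  size U + 2 * d <= m * Z ->
  (exists U' F' x' d', [/\ partial_AP U' F' x' d' l, d' %| d, 0 < d',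
     2 * d' <= d & size U' + 2 = size U + 2 * d]) \/
  (exists U' F' x' u, [/\ partial_AP U' F' x' d (l + u), size U' = size U + 2 &
     size V * l <= 12 * M * u]).
Proof.
move=> pAP d0 lM Vl hU; set Q := l %/ 2; have [DUF hAP] := pAP.
have Q2 : 2 * Q <= l by rewrite /Q; lia.
have lQ : l <= 2 * Q + 1 by rewrite /Q; lia.
have QM : Q <= M by lia.
have VQ : 8 * M <= size V * Q.
  have VsM : size V <= M.+1.
    rewrite -(size_iota 0 M.+1); apply: uniq_leq_size => // v vV.
    by rewrite mem_iota /= ltnS VM.
  have : size V * l <= size V * (2 * Q + 1) by rewrite leq_mul2l lQ orbT.
  by lia.
have [d1|d1] := ltnP 1 d; last first.
  right; apply: (@partial_AP_grow U [::] F F x d l Q) => //.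
    by rewrite addn0; lia.
  by move=> a b _ _ _ _; have -> : d = 1; [lia | rewrite dvd1n].
pose R a b := [&& a < b, b - a <= Q & ~~ (d %| b - a)].
have Rirr a : ~~ R a a by rewrite /R ltnn.
case: (extract_pairs d.-1 F Rirr) => [[P [F' [sP PR PF]]]|[G [F' [sG GF noR]]]].
  left; pose delta := [seq p.2 - p.1 | p <- P].
  have [d' [x' [d'd d'0 d'lt hAP']]] : exists d' x',
      [/\ d' %| d, 0 < d', d' < d & has_AP (U ++ unpair P) x' d' l].
    apply: (@has_AP_reduce _ _ delta (sumn [seq p.1 | p <- P]) x d l Q) => //.
    - by rewrite size_map sP prednK.
    - by apply/allP=> _ /mapP[p /(allP PR)/and3P[_ _ ?] ->].
    - by move=> _ /mapP[p /(allP PR)/and3P[_ ? _] ->].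
    - move=> y; apply: subsum_unpair; apply/allP=> p /(allP PR)/and3P[? _ _].
      exact: ltnW.
  exists (U ++ unpair P), F', x', d'; split=> //.
  - split=> //; apply: (perm_trans DUF); rewrite -catA perm_cat2l.
    exact: PF.
  - case/dvdnP: d'd d'lt => -[|[|q]] ->; rewrite ?mul1n ?ltnn ?mul0n //.
    by rewrite leq_mul2r; lia.
  - by rewrite size_cat size_unpair sP; lia.
right; apply: (@partial_AP_grow U G F F' x d l Q) => //; first by lia.
move=> a b aF bF ab abQ; have := noR a b aF bF; rewrite /R ab abQ /=.
by rewrite negbK.
Qed.

(** [G] bounds the number of growth steps, each of which adds at least [size V * l0 / (12 * M)] to
    the length. The potential [size U + 4 * d + 2 * G] never increases: a growth step trades one
    unit of [G] for two elements, a reduction consumes [2 * d - 2] elements and at least halves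
    [d]. *)
Lemma partial_AP_double l0 G U F x d l :
  24 * M <= size V * l0 -> partial_AP U F x d l -> 0 < d -> l0 <= l ->
  24 * M * l0 <= 12 * M * l + G * (size V * l0) ->
  size U + 4 * d + 2 * G <= m * Z ->
  exists U' F' x' d' l', [/\ partial_AP U' F' x' d' l', d' %| d, 0 < d',
    size U' + 4 * d' <= size U + 4 * d + 2 * G &
    (2 * l0 <= l') || (2 * M <= l')].
Proof.
move=> Vl0; have [k] := ubnP (G + d); elim: k G U F x d l => // k IH G U F x d l.
move=> Gdk pAP d0 l0l Gl hU.
have [big|] := boolP ((2 * l0 <= l) || (2 * M <= l)).
  by exists U, F, x, d, l; split=> //; lia.
rewrite negb_or -!ltnNge => /andP[ll0 lM].
have Vl : 24 * M <= size V * l by apply: leq_trans Vl0 _; rewrite leq_mul2l l0l orbT.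
case: (partial_AP_step pAP d0 lM Vl); first by lia.
  case=> U1 [F1 [x1 [d1 [pAP1 d1d d10 d1h sU1]]]].
  case: (IH G U1 F1 x1 d1 l) => // [||U2 [F2 [x2 [d2 [l2 [? ? ? ? ?]]]]]]; try lia.
  exists U2, F2, x2, d2, l2; split=> //; first exact: dvdn_trans d1d.
  by lia.
case=> U1 [F1 [x1 [u [pAP1 sU1 hu]]]].
case: G => [|G] in Gdk Gl hU *.
  have : 24 * M * l0 <= 12 * M * (2 * l0).-1.
    by apply: leq_trans Gl _; rewrite mul0n addn0 leq_mul2l; lia.
  by nia.
case: (IH G U1 F1 x1 d (l + u)) => // [|||U2 [F2 [x2 [d2 [l2 [? ? ? ? ?]]]]]].
- by lia.
- have : size V * l0 <= size V * l by rewrite leq_mul2l l0l orbT.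
  by move: Gl hu; rewrite mulSn mulnDr; lia.
- by lia.
by exists U2, F2, x2, d2, l2; split=> //; lia.
Qed.

Lemma partial_AP_climb J G U F x d l :
  12 * M <= G * size V -> 24 * M <= size V * l -> 2 * M <= 2 ^ J * l ->
  partial_AP U F x d l -> 0 < d -> size U + 4 * d + 2 * G * J <= m * Z ->
  exists U' F' x' d' l', [/\ partial_AP U' F' x' d' l', d' %| d, 0 < d',
    size U' + 4 * d' <= size U + 4 * d + 2 * G * J & 2 * M <= l'].
Proof.
move=> GV; elim: J U F x d l => [|J IH] U F x d l Vl Jl pAP d0 hU.
  by exists U, F, x, d, l; split=> //; lia.
have [||U1 [F1 [x1 [d1 [l1 [pAP1 d1d d10 sU1 hl1]]]]]] :=
  @partial_AP_double l G U F x d l Vl pAP d0 (leqnn l).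
- have : 12 * M * l <= G * size V * l by rewrite leq_mul2r GV orbT.
  by lia.
- by rewrite mulnS in hU; lia.
have [l1M|l1M] := leqP (2 * M) l1.
  by exists U1, F1, x1, d1, l1; split=> //; lia.
have ll1 : 2 * l <= l1 by lia.
case: (IH U1 F1 x1 d1 l1) => // [|||U2 [F2 [x2 [d2 [l2 [? ? ? ? ?]]]]]].
- apply: leq_trans Vl _; rewrite leq_mul2l; lia.
- by apply: leq_trans Jl _; rewrite expnSr -mulnA leq_mul2l ll1 orbT.
- by rewrite mulnS in hU; lia.
exists U2, F2, x2, d2, l2; split=> //; first exact: dvdn_trans d1d.
by rewrite mulnS; lia.
Qed.

(** If the extraction gets stuck, [block_available] with [d = 1] still finds two distinct values at
    distance at most [M1] in the rest. *)
Lemma close_pairs N1 M1 : 8 * M <= size V * M1 -> M1 <= M -> 2 * N1 <= m * Z ->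
  exists P F, [/\ size P = N1, all (fun p => (p.1 < p.2) && (p.2 - p.1 <= M1)) P &
    perm_eq D (unpair P ++ F)].
Proof.
move=> VM1 M1M hN1.
case: (@extract_pairs (fun a b => (a < b) && (b - a <= M1)) N1 D) => //.
  by move=> a; rewrite ltnn.
case=> G [F [sG DGF noR]]; exfalso.
have M10 : 0 < M1 by case: (M1) VM1 => //; rewrite muln0; lia.
have [||a [u [aF auF uM su]]] := @block_available G F M1 1 DGF _ M10 isT.
- exact: ltnW (leq_trans sG hN1).
- by move=> a b; rewrite dvd1n.
rewrite mul1n in auF uM.
suff u0 : 0 < u by have := noR _ _ aF auF; rewrite addKn uM -ltn_subLR ?subnn ?u0.
case: u su {auF uM} => // su.
have hM : M1 * (M %/ M1).+1 <= 2 * M by rewrite mulnS mulnC; have := leq_divM M M1; lia.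
have := leq_mul (leqnn M1) su; lia.
Qed.

(** One level of the recursion: the differences of [N1] close pairs have a progression by
    assumption, [subsum_unpair] transfers it to [D], and [partial_AP_climb] lengthens it from
    [2 * M1] to [2 * M]. *)
Lemma level_AP N1 M1 G L :
  12 * M <= size V * M1 -> M1 <= M -> 12 * M <= G * size V -> size V <= 2 ^ L ->
  2 * N1 + 4 * M1 + 2 * G * L <= m * Z ->
  (forall E, size E = N1 -> all (fun e => 0 < e <= M1) E ->
     exists x d l, [/\ has_AP E x d l, 0 < d <= M1 & 2 * M1 <= l]) ->
  exists U F x d l, [/\ partial_AP U F x d l, 0 < d <= M1,
    size U + 4 * d <= 2 * N1 + 4 * M1 + 2 * G * L & 2 * M <= l].
Proof.
move=> VM1 M1M GV VL hZ hE.
have [|||P [F [sP PR DPF]]] := @close_pairs N1 M1; try lia.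
have [||x [d [l [hAP /andP[d0 dM1] M1l]]]] := hE [seq p.2 - p.1 | p <- P].
- by rewrite size_map.
- by apply/allP=> _ /mapP[p /(allP PR)/andP[? ?] ->]; rewrite subn_gt0; apply/andP.
have pAP : partial_AP (unpair P) F (sumn [seq p.1 | p <- P] + x) d l.
  split=> // j jl; rewrite -addnA; apply: subsum_unpair; last exact: hAP.
  by apply/allP=> p /(allP PR)/andP[/ltnW].
(* Already [size V * l] is at least [24 * M], so [L] doublings suffice because of
   [size V <= 2 ^ L]. *)
have Vl : size V * (2 * M1) <= size V * l by rewrite leq_mul2l M1l orbT.
have Ll : size V * l <= 2 ^ L * l by rewrite leq_mul2r VL orbT.
have sU : size (unpair P) = 2 * N1 by rewrite size_unpair sP.
have [|||U1 [F1 [x1 [d1 [l1 [pAP1 d1d d10 sU1 hl1]]]]]] :=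
  @partial_AP_climb L G _ _ _ _ _ GV _ _ pAP d0; try lia.
have d1d' := dvdn_leq d0 d1d.
by exists U1, F1, x1, d1, l1; split=> //; lia.
Qed.

End Climb.

(** * Progressions in dense multi-sets *)

Lemma has_AP_nseq (D : seq nat) v m : m <= count_mem v D -> has_AP D 0 v m.
Proof.
move=> hm j jm; exists (nseq j v), (nseq (count_mem v D - j) v ++ filter (predC1 v) D).
split; last by rewrite sumn_nseq add0n.
rewrite catA -nseqD subnKC ?(leq_trans jm) // perm_sym.
have -> : nseq (count_mem v D) v = filter (pred1 v) D.
  by rewrite -size_filter; apply/esym/all_pred1P/filter_all.
by rewrite perm_filterC.
Qed.

Lemma count_le_undup (P : pred nat) (D : seq nat) K :
  (forall v, v \in D -> P v -> count_mem v D <= K) ->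
  count P D <= size [seq v <- undup D | P v] * K.
Proof.
move=> hK; rewrite -sum1_count -big_undup_iterop_count /=.
rewrite -big_filter -sum1_size big_distrl /= big_seq [leqRHS]big_seq.
apply: leq_sum => v; rewrite mem_filter mem_undup => /andP[Pv vD].
rewrite mul1n; apply: leq_trans (hK v vD Pv).
by rewrite Monoid.iteropE /= iter_addn_0 mul1n.
Qed.

Lemma uniq_size_le (V : seq nat) M :
  uniq V -> (forall v, v \in V -> 0 < v <= M) -> size V <= M.
Proof.
move=> uV hV; rewrite -(size_iota 1 M); apply: uniq_leq_size => // v /hV.
by rewrite mem_iota; lia.
Qed.

Lemma mul_size_le (V D : seq nat) m :
  uniq V -> (forall v, v \in V -> m <= count_mem v D) -> m * size V <= size D.
Proof.
move=> uV hm; apply: leq_trans (sum_count_le D uV).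
rewrite mulnC -sum1_size big_distrl /= big_seq [leqRHS]big_seq.
by apply: leq_sum => v vV; rewrite mul1n hm.
Qed.

(** Exceeds the ceiling by one if [b] divides [a]; only the bounds of [ceil_divP] matter. *)
Definition ceil_div (a b : nat) := (a %/ b).+1.

Lemma ceil_divP a b : 0 < b -> a <= b * ceil_div a b <= a + b.
Proof.
by move=> b0; have := leq_divM a b; have := ltn_ceil a b0; rewrite /ceil_div mulnS mulnC; lia.
Qed.

(** Induction on [M]. One of the [L] dyadic levels of multiplicity holds a share [1 / L] of [D]. If
    its values occur at least [2 * M] times, the multiples of one value suffice; otherwise there are
    at least [500 * L] values, so that [M1], about [12 * M / size V], is smaller than [M] and
    [level_AP] applies. *)
Lemma dense_AP L M (D : seq nat) :
  0 < L -> 0 < M -> all (fun e => 0 < e <= M) D -> 2000 * L ^ 2 * M <= size D ->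
  size D < 2 ^ L ->
  exists x d l, [/\ has_AP D x d l, 0 < d <= M & 2 * M <= l].
Proof.
move=> L0; have [k] := ubnP M; elim: k M D => // k IH M D Mk M0 DM DL D2.
pose f v := trunc_log 2 (count_mem v D).
have [|r rL hr] := @pigeonhole_count _ f L D L0.
  apply/allP=> v _; rewrite /f -(ltn_exp2l _ _ (isT : 1 < 2)).
  have [->|c0] := posnP (count_mem v D); first by rewrite trunc_log0 expn0; lia.
  by apply: leq_ltn_trans D2; apply: leq_trans (trunc_logP _ c0) _; rewrite // count_size.
pose V : seq nat := [seq v <- undup D | f v == r]; pose m := 2 ^ r.
have VD v : v \in V -> v \in D by rewrite mem_filter mem_undup => /andP[].
have uV : uniq V by rewrite filter_uniq ?undup_uniq.
have m0 : 0 < m by rewrite expn_gt0.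
have Vm v : v \in V -> m <= count_mem v D.
  move=> vV; have vD := VD v vV; move: vV; rewrite /m mem_filter => /andP[/eqP <- _].
  by apply: trunc_logP => //; rewrite -has_count has_pred1.
have VM v : v \in V -> 0 < v <= M by move=> /VD/(allP DM).
have hs : size D <= L * (size V * (2 * m)).
  apply: leq_trans hr _; rewrite leq_mul2l; apply/orP; right.
  rewrite /m -expnS; apply: count_le_undup => v _ /eqP <-; apply: ltnW.
  exact: trunc_log_ltn.
have mV : m * size V <= size D by apply: mul_size_le.
have VsM := uniq_size_le uV VM.
have VmL : 1000 * L * M <= size V * m.
  have : L * (2000 * L * M) <= L * (size V * (2 * m)).
    by apply: leq_trans hs; apply: leq_trans DL; rewrite -mulnn; lia.
  by rewrite leq_pmul2l //; lia.
have LM0 : 0 < L * M by rewrite muln_gt0 L0.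
have [Mm|mM] := leqP (2 * M) m.
  have V0 : 0 < size V by case: (size V) VmL => //; lia.
  have vV : nth 0 V 0 \in V by rewrite mem_nth.
  by exists 0, (nth 0 V 0), m; split=> //; [apply/has_AP_nseq/Vm | apply: VM].
have sL : 500 * L <= size V.
  have : size V * m <= size V * (2 * M) by rewrite leq_mul2l (ltnW mM) orbT.
  move=> h; rewrite -(leq_pmul2r M0) -(leq_pmul2l (isT : 0 < 2)); lia.
have sm : 500 * (1000 * (L ^ 2 * M)) <= size V * (size V * m).
  have := leq_mul sL VmL; rewrite -mulnn; lia.
have V0 : 0 < size V by lia.
pose M1 := ceil_div (12 * M) (size V); have /andP[M1l M1u] := ceil_divP (12 * M) V0.
rewrite -/M1 in M1l M1u.
have M1M : M1 < M.
  rewrite ltnNge; apply/negP => h.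
  have : size V * M <= size V * M1 by rewrite leq_mul2l h orbT.
  have : 500 * M <= size V * M by rewrite leq_mul2r; lia.
  lia.
pose Z := size V %/ 4.
(* After multiplication by [size V] the left side is of order [L ^ 2 * M], since
   [size V * M1 <= 13 * M], and [sm] bounds the right side from below. *)
have mZ : 2 * (2000 * L ^ 2 * M1) + 4 * M1 + 2 * M1 * L <= m * Z.
  rewrite -(leq_pmul2l V0).
  have h1 : size V * (m * size V) <= size V * (m * (5 * Z)).
    by rewrite leq_mul2l leq_mul2l /Z; lia.
  have h2 : 4 * M1 + 2 * M1 * L <= 6 * (L ^ 2 * M1).
    have : L * M1 <= L ^ 2 * M1 by rewrite leq_mul2r -mulnn leq_pmulr ?orbT.
    have : M1 <= L * M1 by rewrite leq_pmull.
    lia.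
  have h3 : L ^ 2 * (size V * M1) <= L ^ 2 * (13 * M) by rewrite leq_mul2l; lia.
  have h4 := leq_mul (leqnn (size V)) h2.
  move: h1 h3 h4 sm; move: (size V) (L ^ 2) (m) (M1) (Z); clear; lia.
have [|||||||U [F [x [d [l [[DUF hAP] /andP[d0 dM1] _ hl]]]]]] :=
  @level_AP V D M m Z uV M0 m0 _ Vm _ _ (2000 * L ^ 2 * M1) M1 M1 L M1l _ _ _ mZ _.
all: try by [lia | move=> v /VM; lia].
- apply: leq_trans (ltnW D2); apply: leq_trans mV; exact: leq_pmull.
- move=> E sE hE; apply: IH => //; [lia|lia|].
  rewrite sE; apply: leq_ltn_trans D2; apply: leq_trans mV.
  have : m * Z <= m * size V by rewrite leq_mul2l /Z; lia.
  lia.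
exists x, d, l; split=> //; last by lia.
apply: (@has_AP_perm (U ++ F)); first by rewrite perm_sym.
by move=> j /hAP; apply: subsum_catl.
Qed.

(** * Common subset sums of two multi-sets *)

Lemma zero_sum_mod (B : seq nat) d : 0 < d -> d <= size B ->
  exists E F, [/\ perm_eq B (E ++ F), 0 < size E <= d & d %| sumn E].
Proof.
move=> d0 dB; pose r k := sumn (take k B) %% d.
(* The [d + 1] prefixes of length at most [d] have only [d] possible residues of their sums, so two
   agree; the elements between them form [E]. *)
have : ~~ uniq [seq r k | k <- iota 0 d.+1].
  apply/negP => u; suff : d.+1 <= d by rewrite ltnn.
  rewrite -{1}(size_iota 0 d.+1) -(size_map r) -[X in _ <= X](size_iota 0).
  by apply: uniq_leq_size => // _ /mapP[k _ ->]; rewrite mem_iota ltn_mod.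
case/(uniqPn 0) => i [j [ij]]; rewrite size_map size_iota => jd.
have id := ltn_trans ij jd.
rewrite !(nth_map 0) ?size_iota // !nth_iota // !add0n /r => /eqP rij.
have sub : sumn (take j B) = sumn (take i B) + sumn (drop i (take j B)).
  by rewrite -sumn_cat -{1}(take_takel B (ltnW ij)) cat_take_drop.
exists (drop i (take j B)), (take i B ++ drop j B); split.
- rewrite -{1}(cat_take_drop j B) -{1}(cat_take_drop i (take j B)).
  by rewrite take_takel ?(ltnW ij) // -catA perm_catCA.
- have jB : j <= size B by apply: leq_trans dB.
  by rewrite size_drop size_takel // subn_gt0 ij (leq_trans (leq_subr _ _)).
by move: rij; rewrite eq_sym eqn_mod_dvd sub ?leq_addr // addKn.
Qed.

(** Blocks of at most [d] elements whose sum is a multiple of [d] are taken out of [B] until [t] is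
    reached. Until then the remaining sum exceeds [d * M], so at least [d] elements remain. *)
Lemma subsum_multiple (B : seq nat) M d t :
  all (fun b => 0 < b <= M) B -> 0 < d -> t + d * M <= sumn B ->
  exists y, [/\ subsum B y, d %| y & t <= y <= t + d * M].
Proof.
move=> BM d0; have [k] := ubnP t; elim: k t B BM => // k IH t B BM tk tB.
have [->|t0] := posnP t.
  by exists 0; split=> //; exact: subsum0.
have hM (C : seq nat) : {subset C <= B} -> sumn C <= size C * M.
  by move=> CB; apply: sumn_le_size => v /CB/(allP BM)/andP[].
have dB : d <= size B.
  have h := hM B (fun v => id); rewrite leqNgt; apply/negP => Bd.
  have : size B * M <= d * M by rewrite leq_mul2r (ltnW Bd) orbT.
  lia.
have [E [F [BEF /andP[E0 Ed] dE]]] := zero_sum_mod d0 dB.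
have EB : {subset E <= B} by move=> v vE; rewrite (perm_mem BEF) mem_cat vE.
have FB : {subset F <= B} by move=> v vF; rewrite (perm_mem BEF) mem_cat vF orbT.
have sE := hM E EB.
have sEd : size E * M <= d * M by rewrite leq_mul2r Ed orbT.
have sBE : sumn B = sumn E + sumn F by rewrite (perm_sumn BEF) sumn_cat.
have [tE|Et] := leqP t (sumn E).
  exists (sumn E); split=> //; first by exists E, F.
  by rewrite tE (leq_trans sE) // (leq_trans sEd) // leq_addl.
have sE0 : 0 < sumn E.
  case: (E) E0 EB => // e E' _ /(_ e (mem_head _ _))/(allP BM)/andP[e0 _] /=.
  by rewrite addn_gt0 e0.
case: (IH (t - sumn E) F) => [|||y [Fy dy hy]].
- by apply/allP=> v /FB/(allP BM).
- by lia.
- by lia.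
exists (sumn E + y); split; last by lia.
  apply: (@subsum_perm (E ++ F)); first by rewrite perm_sym.
  by apply: subsum_cat => //; exists E, [::]; rewrite cats0.
by rewrite dvdn_add.
Qed.

(** From [x] on, the progression contains all multiples of [d] in a window longer than [d * M],
    where [subsum_multiple] finds a subset sum of [B]. The target [x + d] makes it positive. *)
Lemma common_subsum_AP (A B : seq nat) M x d l :
  has_AP A x d l -> d %| x -> 0 < d -> M < l -> all (fun b => 0 < b <= M) B ->
  x + d + d * M <= sumn B ->
  exists2 z, 0 < z & subsum A z /\ subsum B z.
Proof.
move=> hA dx d0 Ml BM hB; have [y [By dy /andP[y1 y2]]] := subsum_multiple BM d0 hB.
exists y; first by lia.
split=> //; have -> : y = x + d * ((y - x) %/ d).
  by rewrite mulnC divnK ?dvdn_sub //; lia.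
apply: hA; rewrite -(leq_pmul2l d0) [d * (_ %/ _)]mulnC divnK ?dvdn_sub //.
have : d * M.+1 <= d * l by rewrite leq_mul2l Ml orbT.
by rewrite mulnS; lia.
Qed.

(** As long as some [d] divides all but at most [Z] values but not all, the exceptions are dropped.
    The common divisor [g] then at least doubles; it cannot exceed [M], so this happens at most [K]
    times. *)
Lemma almost_divisors (V : seq nat) M Z K g :
  uniq V -> (forall v, v \in V -> 0 < v <= M) ->
  (forall v, v \in V -> g %| v) -> M < g * 2 ^ K -> K * Z < size V ->
  exists W : seq nat, [/\ uniq W, {subset W <= V}, size V <= size W + K * Z &
    forall d, d <= M -> count (fun v => ~~ (d %| v)) W <= Z ->
      {in W, forall v, d %| v}].
Proof.
elim: K V g => [|K IH] V g uV VM gV MK KV.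
  case: V KV {uV} VM gV => // v V _ /(_ v (mem_head _ _)) vM /(_ v (mem_head _ _)) gv.
  by have := dvdn_leq _ gv; move: MK; rewrite expn0; lia.
have [hV|] := boolP (all (fun d => (count (fun v => ~~ (d %| v)) V <= Z)
    ==> all (fun v => d %| v) V) (iota 0 M.+1)).
  exists V; split=> //; first exact: leq_addr.
  by move=> d dM hd; apply/allP; apply: implyP hd; apply: (allP hV); rewrite mem_iota.
case/allPn => d _; rewrite negb_imply => /andP[hd /allPn[v vV dv]].
pose V1 := [seq v <- V | d %| v].
have V1V : {subset V1 <= V} by move=> w; rewrite mem_filter => /andP[].
have sV : size V <= size V1 + Z.
  by rewrite size_filter -(count_predC (fun v => d %| v) V) leq_add2l.
have g0 : 0 < g by case: (g) MK => //; rewrite mul0n.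
have d0 : 0 < d.
  rewrite lt0n; apply/negP => /eqP d0; move: hd; rewrite d0.
  have -> : count (fun v => ~~ (0 %| v)) V = size V.
    rewrite -count_predT; apply: eq_in_count => w /VM/andP[w0 _] /=.
    by rewrite dvd0n -lt0n w0.
  by move: KV; rewrite mulSn; lia.
have g1 : 2 * g <= lcmn d g.
  have := dvdn_lcmr d g; case/dvdnP=> -[|[|q]] E.
  - by have := lcmn_gt0 d g; rewrite E mul0n d0 g0.
  - by case/negP: dv; apply: dvdn_trans (gV v vV); rewrite -[g]mul1n -E dvdn_lcml.
  by rewrite E leq_mul2r; lia.
case: (IH V1 (lcmn d g)) => [||w|||W [uW WV sW hW]].
- exact: filter_uniq.
- by move=> w /V1V/VM.
- by rewrite mem_filter dvdn_lcm => /andP[-> /gV].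
- apply: leq_trans MK _; rewrite expnSr [_ * 2]mulnC mulnA leq_mul2r; lia.
- by rewrite mulSn in KV; lia.
exists W; split=> //; first by move=> w /WV/V1V.
by rewrite mulSn; lia.
Qed.

(** If [d] does not divide all of [W], it fails for more than [Z] values, hence for more elements of
    [D] than have been consumed; [d - 1] of those left reduce [d]. As [d] at least halves each time,
    [2 * d] elements pay for all reductions. *)
Lemma partial_AP_divisor (W D : seq nat) M M1 m Z U F x d l :
  uniq W -> {subset D <= W} -> (forall v, v \in W -> 0 < v <= M) ->
  (forall v, v \in W -> m <= count_mem v D) ->
  (forall e, e <= M1 -> count (fun v => ~~ (e %| v)) W <= Z ->
     {in W, forall v, e %| v}) ->
  partial_AP D U F x d l -> 0 < d <= M1 -> 2 * M <= l ->
  size U + 2 * d <= m * Z ->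
  exists U' F' x' d', [/\ partial_AP D U' F' x' d' l, 0 < d' <= d,
    size U' <= size U + 2 * d & {in W, forall v, d' %| v}].
Proof.
move=> uW DW WM Wm hW; have [k] := ubnP d; elim: k U F x d => // k IH U F x d dk.
move=> [DUF hAP] /andP[d0 dM1] Ml hU.
pose p v := ~~ (d %| v).
have [pZ|Zp] := leqP (count p W) Z.
  exists U, F, x, d; split=> //; rewrite ?d0 ?leqnn ?leq_addr //.
  exact: hW.
have d1 : 1 < d.
  rewrite ltn_neqAle d0 andbT eq_sym; apply: contraTneq Zp => d1.
  rewrite -leqNgt (@eq_count _ _ pred0) ?count_pred0 // => v.
  by rewrite /p d1 dvd1n.
have pD : m * Z.+1 <= count p D.
  rewrite -!size_filter; apply: (@leq_trans (m * size [seq v <- W | p v])).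
    by rewrite leq_mul2l size_filter Zp orbT.
  apply: mul_size_le (filter_uniq _ uW) _ => v; rewrite mem_filter => /andP[pv vW].
  rewrite count_filter; apply: leq_trans (Wm v vW) _.
  by rewrite sub_count // => u /= /eqP ->; rewrite eqxx.
have pF : d.-1 <= size [seq v <- F | p v].
  rewrite (permP DUF) count_cat in pD; rewrite size_filter.
  have := count_size p U; rewrite mulnS in pD.
  by move: pD hU; move: (count p U) (count p F) (size U); clear; lia.
pose E := take d.-1 [seq v <- F | p v].
pose F' := drop d.-1 [seq v <- F | p v] ++ [seq v <- F | predC p v].
have FE : perm_eq F (E ++ F').
  by rewrite /E /F' catA cat_take_drop perm_sym perm_filterC.
have Ep v : v \in E -> p v /\ v \in F.
  by move=> /mem_take; rewrite mem_filter => /andP[].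
have FW v : v \in F -> v \in W.
  by move=> vF; apply: DW; rewrite (perm_mem DUF) mem_cat vF orbT.
have sE : (size E).+1 = d by rewrite size_takel // prednK.
(* The elements themselves, at most [M], serve as summands, without a shift. *)
have [|||d' [x' [d'd d'0 d'lt hAP']]] :=
  @has_AP_reduce U E E 0 x d l M d1 sE _ _ Ml _ hAP.
- by apply/allP=> v /Ep[].
- by move=> v /Ep[_ /FW/WM/andP[]].
- by move=> y.
have d'2 : 2 * d' <= d.
  case/dvdnP: d'd d'lt => -[|[|q]] ->; rewrite ?mul1n ?ltnn ?mul0n //.
  by rewrite leq_mul2r; lia.
have sUE : size (U ++ E) + 1 = size U + d by rewrite size_cat -addnA addn1 sE.
case: (IH (U ++ E) F' x' d') => [||||| U2 [F2 [x2 [d2 [pAP2 hd2 sU2 h2]]]]]; try lia.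
- by split=> //; rewrite -catA; apply: (perm_trans DUF); rewrite perm_cat2l.
exists U2, F2, x2, d2; split=> //; lia.
Qed.

(* Either some value is so frequent that its multiples form a long arithmetic
   progression, or [level_AP] applies; the almost divisors are removed first, so
   that the difference of the final progression divides everything in use.
   Large constants are nested products because the numerals of [nat] are unary. *)
Lemma common_subsum L M m (V A B : seq nat) :
  0 < L -> 0 < M -> uniq V -> (forall v, v \in V -> 0 < v <= M) ->
  (forall v, v \in V -> m <= count_mem v A) -> size A < 2 ^ L ->
  2000 * (1000 * (L ^ 3 * M)) <= size V ^ 2 * m ->
  all (fun b => 0 < b <= M) B ->
  110 * (1000 * (L ^ 3 * M ^ 2)) <= size V * sumn B ->
  exists2 z, 0 < z & subsum A z /\ subsum B z.
Proof.
move=> L0 M0 uV VM Vm AL hA BM hB.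
have LM0 : 0 < L ^ 3 * M by rewrite muln_gt0 expn_gt0 L0.
have L23 : L ^ 3 = L * L ^ 2 by rewrite expnS.
have L2 : 0 < L ^ 2 by rewrite expn_gt0 L0.
have M2 : M ^ 2 = M * M by rewrite -mulnn.
have V2 : size V ^ 2 = size V * size V by rewrite -mulnn.
have V0 : 0 < size V by case: (size V) hA => //; lia.
have m0 : 0 < m by case: (m) hA => //; lia.
(* With few values, [hA] forces [M < m], and the multiples of a single value suffice. *)
have [sL|Ls] := ltnP (size V) (64 * L).
  have vV : nth 0 V 0 \in V by rewrite mem_nth.
  have /andP[v0 vM] := VM _ vV.
  have sL2 : size V ^ 2 <= 4096 * L ^ 2.
    by rewrite -!mulnn; have := leq_mul (ltnW sL) (ltnW sL); lia.
  have Mm : M < m.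
    rewrite ltnNge; apply/negP => mM.
    have h1 := leq_mul sL2 mM.
    have : L ^ 2 * M <= L ^ 3 * M by rewrite L23 -mulnA leq_pmull.
    lia.
  apply: (@common_subsum_AP A B M 0 (nth 0 V 0) m) => //.
  - exact/has_AP_nseq/Vm.
  have h1 : size V * sumn B <= 64 * L * sumn B by rewrite leq_mul2r (ltnW sL) orbT.
  have h2 : 1000 * L * M ^ 2 <= L * sumn B.
    have : L * M ^ 2 <= L ^ 3 * M ^ 2 by rewrite L23 leq_mul2r leq_pmulr ?orbT.
    lia.
  have h3 : 1000 * M ^ 2 <= sumn B by rewrite -(leq_pmul2l L0); lia.
  have h4 : nth 0 V 0 * M <= M * M by rewrite leq_mul2r vM orbT.
  have h5 : M <= M * M by rewrite leq_pmulr.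
  by rewrite M2 in h3; lia.
(* The [2 * L] rounds of [almost_divisors] drop at most [2 * L * Z] values, a quarter of [V]. *)
pose Z := size V %/ (8 * L).
have Zl : 8 * L * Z <= size V by rewrite mulnC leq_divM.
have Zu : size V <= 16 * L * Z.
  have : size V < 8 * L * Z.+1 by rewrite mulnC ltn_ceil // muln_gt0 L0.
  have : 1 <= Z by rewrite /Z divn_gt0 ?muln_gt0 ?L0 //; lia.
  by rewrite mulnS => h1 h2; have := leq_mul (leqnn L) h1; lia.
have mV : m * size V <= size A by apply: mul_size_le.
have sA : size V <= size A by apply: leq_trans mV; apply: leq_pmull.
(* By [hA], [M] is at most [size V ^ 2 * m], hence at most [size A ^ 2]. *)
have MK : M < 1 * 2 ^ (2 * L).
  rewrite mul1n mul2n -addnn expnD.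
  have h1 : size V * (m * size V) <= size A * size A by apply: leq_mul.
  have h2 : size A * size A < 2 ^ L * 2 ^ L by apply: ltn_mul.
  have : M <= L ^ 3 * M by rewrite leq_pmull // expn_gt0 L0.
  lia.
have [||W [uW WV sW hW]] := @almost_divisors V M Z (2 * L) 1 uV VM _ MK.
- by move=> v _; rewrite dvd1n.
- by move: Zl V0; clear; lia.
have W2 : size V <= 2 * size W by move: sW Zl; clear; lia.
pose D : seq nat := [seq a <- A | a \in W].
have DW : {subset D <= W} by move=> v; rewrite mem_filter => /andP[].
have AD : perm_eq A (D ++ [seq a <- A | predC (mem W) a]).
  by rewrite perm_sym perm_filterC.
have WM v : v \in W -> 0 < v <= M by move=> /WV/VM.
have Wm v : v \in W -> m <= count_mem v D.
  move=> vW; rewrite count_filter; apply: leq_trans (Vm v (WV v vW)) _.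
  by rewrite sub_count // => u /= /eqP ->; rewrite eqxx.
have WsM := uniq_size_le uW WM.
have W48 : 32 * L <= size W by move: Ls W2; clear; lia.
have W0 : 0 < size W by move: W48 L0; clear; lia.
pose M1 := ceil_div (12 * M) (size W); have /andP[M1l M1u] := ceil_divP (12 * M) W0.
rewrite -/M1 in M1l M1u.
have M1M : M1 <= M.
  rewrite leqNgt; apply/negP => h.
  have : size W * M <= size W * M1 by rewrite leq_mul2l (ltnW h) orbT.
  have : 32 * M <= size W * M.
    by rewrite leq_mul2r; apply/orP; right; apply: leq_trans W48; rewrite leq_pmulr.
  by move: WsM M1u M0; clear; lia.
have LM1 : L * M1 <= L ^ 2 * M1 by rewrite leq_mul2r -mulnn leq_pmulr ?orbT.
have M1LM1 : M1 <= L * M1 by rewrite leq_pmull.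
have WL : L ^ 2 * (size W * M1) <= L ^ 2 * (13 * M).
  rewrite leq_mul2l; apply/orP; right; apply: leq_trans M1u _.
  by move: WsM; clear; lia.
(* [4000] accounts for the pairs whose differences enter [dense_AP], the remainder for prolonging
   the progression and reducing its difference. *)
have mZ : 4008 * (L ^ 2 * M1) <= m * Z.
  rewrite -(leq_pmul2l W0) -(leq_pmul2l L0).
  have h1 : (2 * size W) * (m * size V) <= (2 * size W) * (m * (16 * L * Z)).
    by rewrite leq_mul2l leq_mul2l Zu !orbT.
  have h2 : size V * (m * size V) <= 2 * size W * (m * size V).
    by rewrite leq_mul2r W2 orbT.
  have h3 := leq_mul (leqnn L) WL.
  rewrite V2 L23 in hA; move: hA h1 h2 h3; clear.
  by move: (size V) (size W) (L ^ 2) (m) (M1) (Z); lia.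
have N1L : 2000 * L ^ 2 * M1 < 2 ^ L.
  apply: leq_ltn_trans AL; apply: leq_trans mV.
  have : m * Z <= m * size V.
    by rewrite leq_mul2l; apply/orP; right; apply: leq_trans Zl; rewrite leq_pmull // muln_gt0 L0.
  have : 0 < L ^ 2 * M1 by rewrite muln_gt0 L2.
  by move: mZ; clear; lia.
have hE (E : seq nat) : size E = 2000 * L ^ 2 * M1 -> all (fun e => 0 < e <= M1) E ->
    exists x d l, [/\ has_AP E x d l, 0 < d <= M1 & 2 * M1 <= l].
  by move=> sE hE; apply: (@dense_AP L) => //; rewrite sE.
have M1l' : 12 * M <= M1 * size W by rewrite [M1 * _]mulnC.
have [|||||U [F [x [d [l [pAP /andP[d0 dM1] sU hl]]]]]] :=
  @level_AP W D M m Z uW M0 m0 _ Wm _ _ (2000 * L ^ 2 * M1) M1 M1 L M1l M1M M1l' _ _ hE.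
- by move=> v /WM/andP[].
- have : 8 * Z <= 8 * L * Z by rewrite leq_mul2r leq_pmulr ?orbT.
  by move: Zl W2; clear; lia.
- by apply: leq_trans W48; move: L0; clear; lia.
- exact: leq_trans (uniq_leq_size uW WV) (leq_trans sA (ltnW AL)).
- by apply: leq_trans mZ; move: LM1 M1LM1; clear; lia.
have [|||U1 [F1 [x1 [d1 [[DUF1 hAP1] /andP[d10 d1d] sU1 hd1]]]]] :=
  @partial_AP_divisor W D M M1 m Z U F x d l uW DW WM Wm _ pAP _ hl _.
- by move=> e eM1; apply: hW; apply: leq_trans M1M.
- by rewrite d0.
- by apply: leq_trans mZ; move: sU dM1 LM1 M1LM1; clear; lia.
have U1D : {subset U1 <= D} by move=> v vU; rewrite (perm_mem DUF1) mem_cat vU.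
have Ux1 : subsum U1 x1 by rewrite -[x1]addn0 -(muln0 d1); apply: hAP1.
have sU1M : x1 <= size U1 * M.
  apply: leq_trans (subsum_le Ux1) _; apply: sumn_le_size => v /U1D/DW/WM.
  by case/andP.
(* All elements in use are divisible by [d1], thus so is the start of the progression, as
   [common_subsum_AP] requires. *)
have dx1 : d1 %| x1 by apply: subsum_dvd Ux1 => v /U1D/DW/hd1.
have Ml : M < l by move: M0 hl; clear; lia.
have hxB : x1 + d1 + d1 * M <= sumn B.
  have hd1M : d1 * M <= M1 * M by rewrite leq_mul2r (leq_trans d1d dM1) orbT.
  have d1M : d1 <= M1 * M by apply: leq_trans hd1M; apply: leq_pmulr.
  have hU1 : size U1 * M <= 4008 * (L ^ 2 * M1) * M.
    rewrite leq_mul2r; apply/orP; right.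
    by move: sU sU1 dM1 LM1 M1LM1; clear; lia.
  have M1L : M1 * M <= L ^ 2 * M1 * M by rewrite leq_mul2r leq_pmull ?orbT.
  apply: (@leq_trans (4010 * (L ^ 2 * M1) * M)).
    by move: sU1M hU1 hd1M d1M M1L; clear; lia.
  rewrite -(leq_pmul2l V0).
  have h1 : size V * (4010 * (L ^ 2 * M1) * M) <= 2 * size W * (4010 * (L ^ 2 * M1) * M).
    by rewrite leq_mul2r W2 orbT.
  have h2 := leq_mul WL (leqnn M).
  have h3 : L ^ 2 * (M * M) <= L ^ 3 * (M * M).
    by rewrite L23 leq_mul2r leq_pmull ?orbT.
  rewrite M2 in hB; move: h1 h2 h3 hB; clear.
  by move: (size V) (size W) (L ^ 2) (L ^ 3) (M1) (sumn B); lia.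
have [z z0 [Uz Bz]] := common_subsum_AP hAP1 dx1 d10 Ml BM hxB.
exists z => //; split=> //; apply: subsum_perm (_ : subsum (D ++ _) z).
  by rewrite perm_sym; exact: AD.
apply: subsum_catl; apply: subsum_perm (_ : subsum (U1 ++ F1) z); last exact: subsum_catl.
by rewrite perm_sym.
Qed.

(** * Proximity of optimal solutions *)

Lemma subsum_map (T : finType) (w : T -> nat) (l : seq T) z :
  uniq l -> subsum [seq w i | i <- l] z ->
  exists2 X : {set T}, {subset X <= l} & \sum_(i in X) w i = z.
Proof.
elim: l z => [|i l IH] z /=.
  move=> _ /subsum_le; rewrite leqn0 => /eqP ->.
  by exists set0; [move=> i; rewrite inE | rewrite big_set0].
case/andP=> il ul /subsum_cons[/(IH _ ul)[X Xl <-]|[z' /(IH _ ul)[X Xl <-] ->]].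
  by exists X => // j /Xl; rewrite inE => ->; rewrite orbT.
exists (i |: X); last by rewrite big_setU1 //; apply: contra il; apply: Xl.
by move=> j; rewrite !inE => /predU1P[->|/Xl ->]; rewrite ?eqxx ?orbT.
Qed.

Section Proximity.
Variables (n : nat) (w p : 'I_n -> nat) (W : nat) (x : {ffun 'I_n -> bool}).
Hypothesis n0 : 0 < n.
Hypothesis w0 : forall i, 0 < w i.
Hypothesis ratio : forall i j : 'I_n, i < j -> p j * w i < p i * w j.
Hypothesis optx : optimal w p W x.

Local Notation M := (max_weight w).
Local Notation t := (prefix_length w W).
Local Notation L := (trunc_log 2 (2 * n)).

Lemma sum_setE (f : 'I_n -> nat) (A : {set 'I_n}) :
  \sum_(i in A) f i = \sum_i f i * (i \in A).
Proof. by rewrite big_mkcond; apply: eq_bigr => i _; case: (i \in A); rewrite ?muln1 ?muln0. Qed.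

Lemma le_max_weight i : w i <= M.
Proof. exact: leq_bigmax. Qed.

Lemma no_exchange (X Y : {set 'I_n}) :
  {in X, forall i, ~~ x i} -> {in Y, forall i, x i} -> 0 < \sum_(i in Y) w i ->
  {in X & Y, forall i j : 'I_n, i < j} -> \sum_(i in X) w i != \sum_(i in Y) w i.
Proof.
move=> X0 Y1 Y0 XY; apply/eqP => eXY; case: optx => xW xopt.
pose y : {ffun 'I_n -> bool} := [ffun i => (i \in X) || (x i && (i \notin Y))].
have swap (f : 'I_n -> nat) : \sum_i f i * y i + \sum_(i in Y) f i =
    \sum_i f i * x i + \sum_(i in X) f i.
  rewrite !sum_setE -!big_split /=; apply: eq_bigr => i _; rewrite ffunE.
  have := X0 i; have := Y1 i; case: (i \in X) => /=; case: (i \in Y) => /=.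
  - by move=> /(_ isT) -> /(_ isT).
  - by move=> _ /(_ isT) /negPf ->; lia.
  - by move=> /(_ isT) -> _; lia.
  - by rewrite andbT.
(* After multiplication by the common weight this is [ratio] summed over all pairs. *)
have pXY : \sum_(i in Y) p i < \sum_(i in X) p i.
  rewrite -(ltn_pmul2r Y0) -{1}eXY !big_distrlr /= [ltnRHS]exchange_big /=.
  have [j jY] : exists j, j \in Y.
    by apply/set0Pn; apply: contraTneq Y0 => ->; rewrite big_set0.
  have [i iX] : exists i, i \in X.
    by apply/set0Pn; apply: contraTneq Y0 => X00; rewrite -eXY X00 big_set0.
  have le i' j' : i' \in X -> j' \in Y -> p j' * w i' < p i' * w j'.
    by move=> i'X j'Y; apply/ratio/XY.
  rewrite (bigD1 j) //= [ltnRHS](bigD1 j) //= -addSn; apply: leq_add.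
    rewrite (bigD1 i) //= [leqRHS](bigD1 i) //= -addSn; apply: leq_add; first exact: le.
    by apply: leq_sum => i' /andP[i'X _]; apply/ltnW/le.
  apply: leq_sum => j' /andP[j'Y _]; apply: leq_sum => i' i'X.
  exact/ltnW/le.
have /addIn hw : \sum_i w i * y i + \sum_(i in Y) w i = weight w x + \sum_(i in Y) w i.
  by rewrite swap eXY.
have := xopt y; rewrite {1}/weight hw => /(_ xW); rewrite /profit => hp.
by have := swap p; move: pXY hp; clear; lia.
Qed.

Lemma max_weight_gt0 : 0 < M.
Proof. by case: (n) n0 w w0 => // k _ v v0; apply: leq_trans (v0 ord0) _; apply: leq_bigmax. Qed.

Lemma size_weights_lt (A : {set 'I_n}) : size [seq w i | i <- enum A] < 2 ^ L.
Proof.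
rewrite size_map -cardE; apply: leq_ltn_trans (max_card _) _; rewrite card_ord.
by have := @trunc_log_ltn 2 (2 * n) isT; rewrite expnS ltn_pmul2l.
Qed.

Lemma count_weights (A : {set 'I_n}) v :
  count_mem v [seq w i | i <- enum A] = #|[set i in A | w i == v]|.
Proof.
rewrite count_map -size_filter cardE; apply: perm_size; apply: uniq_perm.
- by rewrite filter_uniq ?enum_uniq.
- exact: enum_uniq.
by move=> i; rewrite mem_filter !mem_enum !inE andbC.
Qed.

Lemma weights_le (A : {set 'I_n}) : all (fun b => 0 < b <= M) [seq w i | i <- enum A].
Proof. by apply/allP=> _ /mapP[i _ ->]; rewrite w0 le_max_weight. Qed.

Lemma sum_weights (A : {set 'I_n}) : sumn [seq w i | i <- enum A] = \sum_(i in A) w i.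
Proof. by rewrite sumnE big_map big_enum. Qed.

Definition frequent (V : seq nat) (m : nat) (A : {set 'I_n}) :=
  forall v, v \in V -> m <= #|[set i in A | w i == v]|.

(** A common subset sum of the weights of [P] and of [Q] would allow an exchange. So the premise of
    [common_subsum] on the total weight fails, where either set can play the frequent one. *)
Lemma exchange_bound (P Q : {set 'I_n}) V m :
  {in P, forall i, ~~ x i} -> {in Q, forall i, x i} ->
  {in P & Q, forall i j : 'I_n, i < j} -> uniq V ->
  2000 * (1000 * (L ^ 3 * M)) <= size V ^ 2 * m ->
  (frequent V m P -> size V * \sum_(i in Q) w i < 110 * (1000 * (L ^ 3 * M ^ 2))) /\
  (frequent V m Q -> size V * \sum_(i in P) w i < 110 * (1000 * (L ^ 3 * M ^ 2))).
Proof.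
move=> P0 Q1 PQ uV hV.
have no z : 0 < z -> subsum [seq w i | i <- enum P] z ->
    subsum [seq w i | i <- enum Q] z -> False.
  move=> z0 /(subsum_map (enum_uniq _))[X XP sX] /(subsum_map (enum_uniq _))[Y YQ sY].
  have XP' i : i \in X -> i \in P by move/XP; rewrite mem_enum.
  have YQ' i : i \in Y -> i \in Q by move/YQ; rewrite mem_enum.
  have := @no_exchange X Y; rewrite sX sY eqxx => h; suff: ~~ true by [].
  by apply: h => // [i /XP'/P0|i /YQ'/Q1|i j /XP' iP /YQ' jQ] //; apply: PQ.
have main (A B : {set 'I_n}) : frequent V m A ->
    110 * (1000 * (L ^ 3 * M ^ 2)) <= size V * \sum_(i in B) w i ->
    exists2 z, 0 < z & subsum [seq w i | i <- enum A] z /\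
      subsum [seq w i | i <- enum B] z.
  move=> fA hB; have M0 := max_weight_gt0; have L0 : 0 < L.
    by apply: trunc_log_max; rewrite // expn1 leq_pmulr.
  have m0 : 0 < m.
    case: (m) hV => //; rewrite muln0 leqNgt => /negP[].
    by rewrite !muln_gt0 L0 M0.
  apply: (@common_subsum L M m V) => //.
  - move=> v /fA /(leq_trans m0) /card_gt0P[i]; rewrite inE => /andP[_ /eqP <-].
    by rewrite w0 le_max_weight.
  - by move=> v vV; rewrite count_weights; apply: fA.
  - exact: size_weights_lt.
  - exact: weights_le.
  - by rewrite sum_weights.
split=> fA; rewrite ltnNge; apply/negP => /(main _ _ fA)[z z0 []].
- by move=> Pz Qz; apply: no Pz Qz.
- by move=> Qz Pz; apply: no Pz Qz.
Qed.

(** Every value has half of its copies inside [A] or half of them outside; one of the two cases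
    covers half of the values. *)
Lemma frequent_split V m (N A : {set 'I_n}) : uniq V -> frequent V m N ->
  exists V', [/\ uniq V', size V <= 2 * size V' &
    frequent V' (uphalf m) (N :&: A) \/ frequent V' (uphalf m) (N :\: A)].
Proof.
move=> uV fN; pose q v := uphalf m <= #|[set i in N :&: A | w i == v]|.
have hq v : v \in V -> ~~ q v -> uphalf m <= #|[set i in N :\: A | w i == v]|.
  move=> /fN; rewrite /q -(cardsID A) -ltnNge.
  have -> : [set i in N | w i == v] :&: A = [set i in N :&: A | w i == v].
    by apply/setP=> i; rewrite !inE andbAC.
  have -> : [set i in N | w i == v] :\: A = [set i in N :\: A | w i == v].
    by apply/setP=> i; rewrite !inE andbA.
  by rewrite !uphalf_half; have := odd_double_half m; lia.
have := count_predC q V; rewrite -!size_filter.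
have [h|h] := leqP (size V) (2 * size (filter q V)) => sV.
  exists (filter q V); split; rewrite ?filter_uniq //.
  by left => v; rewrite mem_filter => /andP[].
exists (filter (predC q) V); split; rewrite ?filter_uniq //.
  by move: sV h; move: (size _) (size _) (size _); clear; lia.
by right => v; rewrite mem_filter => /andP[/= qv /hq]; apply.
Qed.

Lemma prefix_sum_le : \sum_(i < n | i < t) w i <= W.
Proof.
rewrite /t; have : 0 < #|[pred m : 'I_n.+1 | \sum_(i < n | i < m) w i <= W]|.
  apply/card_gt0P; exists ord0; rewrite inE /= big1 //.
by case/(eq_bigmax_cond (fun m : 'I_n.+1 => m : nat)) => m mW ->.
Qed.

Lemma prefix_sum_gt : t < n -> W < \sum_(i < n | i <= t) w i.
Proof.
move=> tn; rewrite ltnNge; apply/negP => h; suff : t < t by rewrite ltnn.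
have tn' : t.+1 < n.+1 by [].
exact: (@leq_bigmax_cond _ _ (fun m : 'I_n.+1 => m : nat) (Ordinal tn')).
Qed.

Lemma weight_prefix :
  weight w x + \sum_(i in [set i : 'I_n | (i < t) && ~~ x i]) w i =
  \sum_(i < n | i < t) w i + \sum_(i in [set i : 'I_n | (t <= i) && x i]) w i.
Proof.
rewrite !sum_setE [X in _ = X + _]big_mkcond -!big_split /=.
apply: eq_bigr => i _; rewrite !inE [t <= i]leqNgt.
by case: (i < t) => /=; case: (x i); rewrite ?muln1 ?muln0 ?addn0.
Qed.

(** With [M] units of budget left, [i] could be added at a profit. *)
Lemma dropped_weight (i : 'I_n) : ~~ x i -> 0 < p i -> W < weight w x + M.
Proof.
move=> xi pi; rewrite ltnNge; apply/negP => hW; case: optx => xW xopt.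
pose y : {ffun 'I_n -> bool} := [ffun j => (j == i) || x j].
have add (f : 'I_n -> nat) : \sum_j f j * y j = f i + \sum_j f j * x j.
  rewrite (bigD1 i) //= [in RHS](bigD1 i) //= ffunE eqxx (negPf xi) muln1 muln0 add0n.
  by congr (_ + _); apply: eq_bigr => j /negPf ji; rewrite ffunE ji.
have := xopt y; rewrite /weight /profit !add.
have -> : w i + \sum_j w j * x j <= W.
  by apply: leq_trans hW; rewrite addnC leq_add2l le_max_weight.
by move=> /(_ isT); rewrite -[leqRHS]add0n leq_add2r leqNgt pi.
Qed.

Lemma dist_prefix (i : 'I_n) :
  `|max_prefix w W i - x i|%N = (if i < t then ~~ x i else x i).
Proof. by rewrite ffunE; case: (i < t); case: (x i). Qed.

(** The near items are mostly chosen or mostly not. One case allows a direct exchange with the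
    changed items of [F]. The other one bounds the changes across the break, and by [weight_prefix]
    the changes in [F] weigh at most [M] more than those. *)
Lemma near_far_bound (N F : {set 'I_n}) V m :
  uniq V -> frequent V m N -> 16 * (1000 * (1000 * (L ^ 3 * M))) <= size V ^ 2 * m ->
  [/\ {in N, forall i : 'I_n, i < t}, {in F, forall i : 'I_n, i < t} &
      {in F & N, forall i j : 'I_n, i < j}] \/
  [/\ {in N, forall i : 'I_n, t <= i}, {in F, forall i : 'I_n, t <= i} &
      {in N & F, forall i j : 'I_n, i < j}] ->
  size V * (\sum_(i in F) w i * `|max_prefix w W i - x i|%N) <=
    230 * (1000 * (L ^ 3 * M ^ 2)).
Proof.
move=> uV fN hV side; have M0 := max_weight_gt0.
have L0 : 0 < L by apply: trunc_log_max; rewrite // expn1 leq_pmulr.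
have LM0 : 0 < L ^ 3 * M by rewrite muln_gt0 expn_gt0 L0.
have sm0 : 0 < size V ^ 2 * m by apply: leq_trans hV; rewrite !muln_gt0 /= in LM0 *.
have /andP[sV0 m0] : (0 < size V) && (0 < m).
  by move: sm0; rewrite muln_gt0 sqrn_gt0.
have [j0 j0N] : exists j, j \in N.
  have /fN : nth 0 V 0 \in V by rewrite mem_nth.
  by move/(leq_trans m0)/card_gt0P=> [j]; rewrite inE => /andP[jN _]; exists j.
have sVM : size V <= M.
  apply: uniq_size_le => // v /fN /(leq_trans m0)/card_gt0P[j].
  by rewrite inE => /andP[_ /eqP <-]; rewrite w0 le_max_weight.
pose A := [set i : 'I_n | x i].
have [V' [uV' sV' fV']] := frequent_split A uV fN.
(* Halving both the number of values and the multiplicity costs at most a factor 8 in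
   [size V ^ 2 * m]. *)
have hV' : 2000 * (1000 * (L ^ 3 * M)) <= size V' ^ 2 * uphalf m.
  have h1 := leq_mul sV' sV'.
  have h2 : m <= 2 * uphalf m by rewrite uphalf_half; have := odd_double_half m; lia.
  have h3 := leq_mul h1 h2.
  by rewrite -!mulnn in hV *; move: hV h3; clear; lia.
pose Dr := [set i : 'I_n | (i < t) && ~~ x i].
pose Ad := [set i : 'I_n | (t <= i) && x i].
have := weight_prefix; rewrite -/Dr -/Ad => wE.
(* Twice 110 comes from [size V <= 2 * size V']; the error [M] adds at most [M ^ 2]. *)
have b2 (a b : nat) : a <= b + M -> size V' * b < 110 * (1000 * (L ^ 3 * M ^ 2)) ->
    size V * a <= 230 * (1000 * (L ^ 3 * M ^ 2)).
  move=> ab hb; apply: (@leq_trans (size V * M + 2 * (size V' * b))).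
    apply: (@leq_trans (size V * (b + M))); first by rewrite leq_mul2l ab orbT.
    rewrite mulnDr addnC leq_add2l mulnA leq_mul2r sV' orbT //.
  have h1 : size V * M <= M ^ 2 by rewrite -mulnn leq_mul2r sVM orbT.
  have h2 : M ^ 2 <= L ^ 3 * M ^ 2 by rewrite leq_pmull // expn_gt0 L0.
  by move: hb h1 h2; move: (size V' * b) (size V * M) (M ^ 2) (L ^ 3 * M ^ 2); clear; lia.
have mono (f : 'I_n -> nat) (B C : {set 'I_n}) :
    B \subset C -> \sum_(i in B) f i <= \sum_(i in C) f i.
  move=> BC; rewrite [leqRHS](big_setID B) /= (setIidPr BC).
  exact: leq_addr.
(* Left of the break: the changed items of [F] are dropped ones, of larger ratio than the items of
   [N]. *)
case: side => -[Nt Ft FN].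
  pose DF := [set i in F | ~~ x i].
  have -> : \sum_(i in F) w i * `|max_prefix w W i - x i|%N = \sum_(i in DF) w i.
    rewrite [RHS]big_mkcond [LHS]big_mkcond; apply: eq_bigr => i _.
    rewrite inE; have [iF|//] := boolP (i \in F).
    by rewrite dist_prefix Ft //; case: (x i); rewrite ?muln0 ?muln1.
  have [->|[i iDF]] := set_0Vmem DF; first by rewrite big_set0 muln0.
  have /andP[iF xi] : (i \in F) && ~~ x i by move: iDF; rewrite inE.
  case: fV' => fV'.
    apply: (@b2 _ (\sum_(i in DF) w i)); first exact: leq_addr.
    apply: (proj2 (@exchange_bound DF (N :&: A) V' (uphalf m) _ _ _ uV' hV')) => //.
    - by move=> k; rewrite inE => /andP[].
    - by move=> k; rewrite !inE => /andP[].
    - by move=> k j; rewrite !inE => /andP[kF _] /andP[jN _]; apply: FN.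
  (* A later item, in [N], has a smaller ratio, so the profit of [i] cannot vanish. *)
  have pi : 0 < p i.
    have := ratio (FN i j0 iF j0N); rewrite lt0n; apply: contraTneq => ->.
    by rewrite mul0n.
  apply: (@b2 _ (\sum_(i in Ad) w i)).
    apply: (@leq_trans (\sum_(i in Dr) w i)).
      by apply: mono; apply/subsetP=> k; rewrite !inE => /andP[/Ft -> ->].
    have h1 := dropped_weight xi pi; have h2 := prefix_sum_le.
    by move: wE h1 h2; clear; lia.
  apply: (proj1 (@exchange_bound (N :\: A) Ad V' (uphalf m) _ _ _ uV' hV')) => //.
  - by move=> k; rewrite !inE => /andP[].
  - by move=> k; rewrite !inE => /andP[].
  - move=> k j; rewrite !inE => /andP[_ /Nt kt] /andP[tj _].
    exact: leq_trans kt tj.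
(* Right of the break: the changed items of [F] are added ones, of smaller ratio than the items of
   [N]. *)
pose AF := [set i in F | x i].
have -> : \sum_(i in F) w i * `|max_prefix w W i - x i|%N = \sum_(i in AF) w i.
  rewrite [RHS]big_mkcond [LHS]big_mkcond; apply: eq_bigr => i _.
  rewrite inE; have [iF|//] := boolP (i \in F).
  by rewrite dist_prefix ltnNge Ft //; case: (x i); rewrite ?muln0 ?muln1.
case: fV' => fV'.
  apply: (@b2 _ (\sum_(i in Dr) w i)).
    apply: (@leq_trans (\sum_(i in Ad) w i)).
      by apply: mono; apply/subsetP=> k; rewrite !inE => /andP[/Ft -> ->].
    have tn : t < n by apply: leq_ltn_trans (ltn_ord j0); apply: Nt.
    have h1 := prefix_sum_gt tn; have [h2 _] := optx.
    have h3 : \sum_(i < n | i <= t) w i <= M + \sum_(i < n | i < t) w i.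
      rewrite (bigD1 (Ordinal tn)) //=; apply: leq_add; first exact: le_max_weight.
      rewrite [leqRHS](eq_bigl (fun i : 'I_n => (i <= t) && (i != Ordinal tn))) // => i.
      by rewrite ltn_neqAle andbC.
    by move: wE h1 h2 h3; clear; lia.
  apply: (proj2 (@exchange_bound Dr (N :&: A) V' (uphalf m) _ _ _ uV' hV')) => //.
  - by move=> k; rewrite !inE => /andP[].
  - by move=> k; rewrite !inE => /andP[].
  - move=> k j; rewrite !inE => /andP[kt _] /andP[/Nt tj _].
    exact: leq_trans kt tj.
apply: (@b2 _ (\sum_(i in AF) w i)); first exact: leq_addr.
apply: (proj1 (@exchange_bound (N :\: A) AF V' (uphalf m) _ _ _ uV' hV')) => //.
- by move=> k; rewrite !inE => /andP[].
- by move=> k; rewrite inE => /andP[].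
- by move=> k j; rewrite !inE => /andP[_ kF] /andP[jN _]; apply: FN.
Qed.

(* When the near set has few copies, the total weight of [I] is small enough. *)
Lemma part_bound (N I : {set 'I_n}) (i0 : 'I_n) V m :
  uniq V -> 0 < size V -> 0 < m -> frequent V m N -> i0 \in I ->
  size (supp_weights w I) <= 2 * size V ->
  (forall v, #|[set i in I | w i == v]| <= m) ->
  [/\ {in N, forall i : 'I_n, i < t}, {in I, forall i : 'I_n, i < t} &
      {in I :\ i0 & N, forall i j : 'I_n, i < j}] \/
  [/\ {in N, forall i : 'I_n, t <= i}, {in I, forall i : 'I_n, t <= i} &
      {in N & I :\ i0, forall i j : 'I_n, i < j}] ->
  2 * size V * (\sum_(i in I) w i * `|max_prefix w W i - x i|%N) <=
    300 * (1000 * (1000 * (L ^ 3 * M ^ 2))).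
Proof.
move=> uV sV m0 fN i0I sI Im side; have M0 := max_weight_gt0.
have L0 : 0 < L by apply: trunc_log_max; rewrite // expn1 leq_pmulr.
have d1 i : `|max_prefix w W i - x i|%N <= 1.
  by rewrite dist_prefix; case: ifP; case: (x i).
have sVM : size V <= M.
  apply: uniq_size_le => // v /fN /(leq_trans m0)/card_gt0P[j].
  by rewrite inE => /andP[_ /eqP <-]; rewrite w0 le_max_weight.
have h2 : M ^ 2 <= L ^ 3 * M ^ 2 by rewrite leq_pmull // expn_gt0 L0.
have [big|small] := leqP (16 * (1000 * (1000 * (L ^ 3 * M)))) (size V ^ 2 * m).
  (* [i0] need not lie beyond [N]; by itself it contributes at most [M]. *)
  rewrite (big_setD1 i0) //=; set S := \sum_(i in I :\ i0) _.
  have hS : size V * S <= 230 * (1000 * (L ^ 3 * M ^ 2)).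
    apply: near_far_bound uV fN big _.
    case: side => -[h h' h'']; [left | right]; split=> // i; rewrite inE => /andP[_].
      exact: h'.
    exact: h'.
  have h3 : w i0 * `|max_prefix w W i0 - x i0|%N <= M.
    by rewrite -[M]muln1 leq_mul ?d1 ?le_max_weight.
  have h1 : size V * (w i0 * `|max_prefix w W i0 - x i0|%N) <= M ^ 2.
    by rewrite -mulnn leq_mul.
  rewrite -mulnA mulnDr; move: hS h1 h2.
  move: (size V * S) (size V * (w i0 * _)) (L ^ 3 * M ^ 2) (M ^ 2); clear; lia.
have hI : \sum_(i in I) w i * `|max_prefix w W i - x i|%N <= #|I| * M.
  rewrite -sum_nat_const; apply: leq_sum => i _.
  by rewrite -[M]muln1 leq_mul ?d1 ?le_max_weight.
have cI : #|I| <= 2 * size V * m.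
  have := @count_le_undup predT [seq w i | i <- enum I] m.
  rewrite count_predT size_map -cardE filter_predT => h.
  apply: leq_trans (h _) _; last by rewrite leq_mul2r sI orbT.
  by move=> v _ _; rewrite count_weights.
apply: (@leq_trans (4 * (size V ^ 2 * m) * M)).
  have := leq_mul (leqnn (2 * size V)) (leq_trans hI (leq_mul cI (leqnn M))).
  by rewrite -mulnn; clear; lia.
have := leq_mul (ltnW small) (leqnn M); rewrite -[M ^ 2]mulnn.
by move: (size V ^ 2 * m) (L ^ 3); clear; lia.
Qed.
End Proximity.

(** * The partition algorithm *)

(** The number of binary digits: one more than the floored logarithm of a positive number, and 0 at
    0. By [bitlen_half] the program can tabulate it. *)
Definition bitlen (x : nat) : nat := if x is 0 then 0 else (trunc_log 2 x).+1.

Lemma bitlen_half x : 0 < x -> bitlen x = (bitlen (x %/ 2)).+1.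
Proof.
case: x => [//|[//|x]] _; rewrite {1}/bitlen trunc_log2S // divn2.
by rewrite -[x.+2./2]/(x./2).+1.
Qed.

Lemma bitlenP x : 0 < x -> 2 ^ (bitlen x).-1 <= x < 2 ^ bitlen x.
Proof. by case: x => // x _; exact: trunc_log_bounds. Qed.

Lemma bitlen_le x : bitlen x <= x.
Proof.
case: x => // x; have /andP[h _] := @bitlenP x.+1 isT.
by apply: leq_trans h; apply: ltn_expl.
Qed.

Lemma leq_bitlen : {homo bitlen : x y / x <= y}.
Proof. by move=> [|x] [|y] // xy; apply: leq_trunc_log. Qed.

(** * Rules for timed execution *)

Section RAM.
Variable X : nat.

Definition runs c s T (Q : state -> Prop) : Prop :=
  exists t s', [/\ exec X c s t s', t <= T & Q s'].

Lemma runs_weaken c s T T' (Q Q' : state -> Prop) :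
  runs c s T Q -> T <= T' -> (forall s', Q s' -> Q' s') -> runs c s T' Q'.
Proof.
move=> [t [s' [e tT q]]] TT h; exists t, s'; split=> //; last exact: h.
exact: leq_trans TT.
Qed.

Lemma runs_seq c1 c2 s T1 T2 (Q1 Q : state -> Prop) :
  runs c1 s T1 Q1 -> (forall s', Q1 s' -> runs c2 s' T2 Q) ->
  runs (Seq c1 c2) s (T1 + T2) Q.
Proof.
move=> [t1 [s1 [e1 h1 q1]]] /(_ s1 q1) [t2 [s2 [e2 h2 q2]]].
exists (t1 + t2), s2; split=> //; last exact: leq_add.
exact: ExecSeq e1 e2.
Qed.

Lemma runs_assign r e s (Q : state -> Prop) :
  fits X s e -> Q (set_reg s r (eval s e)) -> runs (Assign r e) s (cost e).+1 Q.
Proof. by move=> f q; do 2!eexists; split; [exact: ExecAssign | | exact: q]. Qed.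

Lemma runs_write a i e s (Q : state -> Prop) :
  fits X s i -> fits X s e -> Q (set_arr s a (eval s i) (eval s e)) ->
  runs (Write a i e) s (cost i + cost e).+1 Q.
Proof. by move=> f g q; do 2!eexists; split; [exact: ExecWrite | | exact: q]. Qed.

Lemma runs_while e c s T N (Inv : nat -> state -> Prop) :
  (forall i s, i < N -> Inv i s ->
     [/\ fits X s e, eval s e != 0 & runs c s T (Inv i.+1)]) ->
  (forall s, Inv N s -> fits X s e /\ eval s e = 0) ->
  Inv 0 s -> runs (While e c) s ((cost e + T).+1 * N + (cost e).+1) (Inv N).
Proof.
move=> hstep hstop; suff gen k i s0 : i + k = N -> Inv i s0 ->
    runs (While e c) s0 ((cost e + T).+1 * k + (cost e).+1) (Inv N).
  by apply: gen; rewrite add0n.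
elim: k i s0 => [|k IH] i s0.
  rewrite addn0 => -> hI; have [f e0] := hstop s0 hI.
  by do 2!eexists; split; [exact: ExecWhileFalse | rewrite muln0 | exact: hI].
move=> ik hI; have [|f e0 [t1 [s1 [e1 h1 q1]]]] := hstep i s0 _ hI.
  by rewrite -ik -addSnnS leq_addr.
have [|t2 [s2 [e2 h2 q2]]] := IH i.+1 s1 _ q1; first by rewrite addSnnS.
exists (cost e + t1 + t2).+1, s2; split=> //.
  exact: ExecWhileTrue e1 e2.
by rewrite mulnS; move: h1 h2; clear; lia.
Qed.
End RAM.

(* Registers: 3 loop counter, 4 weight of the prefix, 5 its length, 6 maximal
   weight, 7 the numerator of the proximity bounds, 8 item, 9 side.
   Arrays: 4 [bitlen], 5 number of copies of a weight seen on a side, 6 number of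
   weights that reached a level on a side, 7 part of a class plus one. *)
Notation "x |+| y" := (Bin Add x y) (at level 50, left associativity).
Notation "x |-| y" := (Bin Defs.Sub x y) (at level 50, left associativity).
Notation "x |*| y" := (Bin Mul x y) (at level 40, left associativity).

(** The body has no branches: truncated subtraction yields the maximum, and one minus the comparison
    is the indicator that moves the prefix length to the current position. *)
Definition scan_body : cmd :=
  Seq (Assign 6 (Reg 6 |+| (Read 0 (Reg 3) |-| Reg 6)))
  (Seq (Write 4 (Reg 3 |+| Const 1)
     (Read 4 (Bin Div (Reg 3 |+| Const 1) (Const 2)) |+| Const 1))
  (Seq (Assign 4 (Reg 4 |+| Read 0 (Reg 3)))
  (Seq (Assign 5 (Reg 5 |+|
     (Const 1 |-| Bin Lt (Reg 1) (Reg 4)) |*| (Reg 3 |+| Const 1 |-| Reg 5)))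
  (Assign 3 (Reg 3 |+| Const 1))))).

Definition scan : cmd := While (Bin Lt (Reg 3) (Reg 0)) scan_body.

Definition numerator (a b : nat) : cmd :=
  Seq (Assign 7 (Const a |*| Const b |*| Const b
    |*| Read 4 (Reg 0) |*| Read 4 (Reg 0) |*| Read 4 (Reg 0)
    |*| Reg 6 |*| Reg 6))
  (Assign 3 (Const 0)).

(** Every round writes a bound to entry [Reg 2] of array 3, but this register advances only if the
    class is new, so the bound computed at the first item of a class survives. Registers 11 and 12
    hold the level key before and after the item is counted; if they differ, its weight has reached
    a new level. *)
Definition classify_body : cmd :=
  Seq (Assign 9 (Const 1 |-| Bin Lt (Reg 3) (Reg 5)))
  (Seq (Assign 8 (Bin Lt (Reg 3) (Reg 5) |*| (Reg 5 |-| Const 1 |-| Reg 3)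
     |+| Reg 9 |*| Reg 3))
  (Seq (Assign 10 (Const 2 |*| Read 0 (Reg 8) |+| Reg 9))
  (Seq (Assign 11 (Const 2 |*| Read 4 (Read 5 (Reg 10)) |+| Reg 9))
  (Seq (Write 5 (Reg 10) (Read 5 (Reg 10) |+| Const 1))
  (Seq (Assign 12 (Const 2 |*| Read 4 (Read 5 (Reg 10)) |+| Reg 9))
  (Seq (Write 6 (Reg 12) (Read 6 (Reg 12) |+|
     (Const 1 |-| Bin Eq (Reg 11) (Reg 12))))
  (Seq (Assign 13 (Read 4 (Read 6 (Reg 12)) |*| (Const 2 |*| (Reg 0 |+| Const 1))
     |+| Reg 12))
  (Seq (Assign 14 (Bin Eq (Read 7 (Reg 13)) (Const 0)))
  (Seq (Write 3 (Reg 2) (Bin Div (Reg 7) (Const 2 |*| Read 6 (Reg 12))))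
  (Seq (Assign 2 (Reg 2 |+| Reg 14))
  (Seq (Write 7 (Reg 13) (Read 7 (Reg 13) |+| Reg 14 |*| Reg 2))
  (Seq (Write 2 (Reg 8) (Read 7 (Reg 13) |-| Const 1))
  (Assign 3 (Reg 3 |+| Const 1)))))))))))))).

Definition classify : cmd := While (Bin Lt (Reg 3) (Reg 0)) classify_body.

Definition partition_algo : cmd := Seq scan (Seq (numerator 300 1000) classify).

(** * Items, levels and classes *)

Section Classes.
Variables (n t c : nat) (wt : nat -> nat).

(* The items in order of their distance to the break item: first the prefix
   from right to left (side 0), then the other items from left to right. *)
Definition item (k : nat) := if k < t then t.-1 - k else k.
Definition side (k : nat) : nat := t <= k.
(** Pairs are encoded as numbers, which serve as array indices: the parity of [wkey] and of [lkey]
    is the side. *)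
Definition wkey k := 2 * wt (item k) + side k.
Definition copies k v := count (fun j => wkey j == v) (iota 0 k).
Definition lkey k := 2 * bitlen (copies k (wkey k)).+1 + side k.
Definition new_level k := bitlen (copies k (wkey k)) != bitlen (copies k (wkey k)).+1.
(** A weight counts once, at the item that lifts it to the level. *)
Definition reached k u := count (fun j => (lkey j == u) && new_level j) (iota 0 k).
(** For [k < n] the level key is below [2 * n.+1], so it can be recovered as a remainder. *)
Definition class k := bitlen (reached k.+1 (lkey k)) * (2 * n.+1) + lkey k.
Definition first k := class k \notin [seq class j | j <- iota 0 k].
Definition firsts k := filter first (iota 0 k).
Definition classes k := [seq class j | j <- firsts k].
(** At the first item of a class, the divisor bounds the number of distinct weights of the class. *)
Definition bound k := c %/ (2 * reached k.+1 (lkey k)).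

Lemma iotaSr k : iota 0 k.+1 = rcons (iota 0 k) k.
Proof. by rewrite -addn1 iotaD -cats1. Qed.

Lemma copiesS k v : copies k.+1 v = copies k v + (wkey k == v).
Proof. by rewrite /copies iotaSr -cats1 count_cat /= addn0. Qed.

Lemma reachedS k u : reached k.+1 u = reached k u + ((lkey k == u) && new_level k).
Proof. by rewrite /reached iotaSr -cats1 count_cat /= addn0. Qed.

Lemma copies_le k v : copies k v <= k.
Proof. by rewrite -[leqRHS](size_iota 0) count_size. Qed.

Lemma reached_le k v : reached k v <= k.
Proof. by rewrite -[leqRHS](size_iota 0) count_size. Qed.

Lemma size_firsts_le k : size (firsts k) <= k.
Proof. by rewrite size_filter -[leqRHS](size_iota 0) count_size. Qed.

Lemma mem_classes k a :
  (a \in classes k) = (a \in [seq class j | j <- iota 0 k]).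
Proof.
elim: k a => // k IH a; rewrite /classes /firsts iotaSr filter_rcons map_rcons mem_rcons inE.
rewrite -IH; have [f|nf] := boolP (first k).
  by rewrite map_rcons mem_rcons inE.
have : class k \in classes k by rewrite IH; rewrite negbK in nf.
by case: eqP => // ->.
Qed.

Lemma firstE k : first k = (class k \notin classes k).
Proof. by rewrite mem_classes. Qed.

Lemma classesS k :
  classes k.+1 = if first k then rcons (classes k) (class k) else classes k.
Proof. by rewrite /classes /firsts iotaSr filter_rcons; case: ifP; rewrite ?map_rcons. Qed.

Lemma firstsS k :
  firsts k.+1 = if first k then rcons (firsts k) k else firsts k.
Proof. by rewrite /firsts iotaSr filter_rcons. Qed.

Lemma size_classes k : size (classes k) = size (firsts k).
Proof. by rewrite size_map. Qed.

Lemma item_lt k : t <= n -> k < n -> item k < n.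
Proof. by move=> tn kn; rewrite /item; case: (ltnP k t) => // kt; lia. Qed.

Lemma itemK : involutive item.
Proof.
move=> k; rewrite /item; case: (ltnP k t) => h; last by rewrite ltnNge h.
by have -> : t.-1 - k < t; lia.
Qed.

(** The content of array 7: part numbers are shifted by one because 0 marks a class not seen yet. *)
Definition slot k a := if a \in classes k then (index a (classes k)).+1 else 0.

Lemma slot_le k a : slot k a <= size (firsts k).
Proof. by rewrite /slot -size_classes; case: ifP => // h; rewrite index_mem. Qed.

Lemma slotS k a :
  slot k.+1 a = slot k a + (a == class k) * (slot k a == 0) * (size (firsts k)).+1.
Proof.
rewrite /slot classesS -size_classes; have [f|nf] := boolP (first k).
  rewrite firstE in f; rewrite mem_rcons inE -cats1 index_cat.
  have [->|ne] := eqVneq a (class k).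
    by rewrite (negPf f) /= eqxx addn0 add0n !mul1n.
  by rewrite !mul0n addn0 /=; case: (a \in classes k).
rewrite firstE negbK in nf; have [->|ne] := eqVneq a (class k).
  by rewrite nf muln0 addn0.
by rewrite !mul0n addn0.
Qed.
End Classes.

(** * Correctness and running time of the program *)

Section Execution.
Variables (X : nat).

Lemma runs_assign_seq r e v c s T (Q : state -> Prop) :
  fits X s e -> eval s e = v -> runs X c (set_reg s r v) T Q ->
  runs X (Seq (Assign r e) c) s ((cost e).+1 + T) Q.
Proof.
move=> f <- q; apply: (@runs_seq X _ _ _ _ _ (eq (set_reg s r (eval s e)))).
  exact: runs_assign.
by move=> _ <-.
Qed.

Lemma runs_write_seq a i e k v c s T (Q : state -> Prop) :
  fits X s i -> fits X s e -> eval s i = k -> eval s e = v ->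
  runs X c (set_arr s a k v) T Q ->
  runs X (Seq (Write a i e) c) s ((cost i + cost e).+1 + T) Q.
Proof.
move=> f g <- <- q; apply: (@runs_seq X _ _ _ _ _ (eq (set_arr s a (eval s i) (eval s e)))).
  exact: runs_write.
by move=> _ <-.
Qed.

Variables (n W B : nat) (wt : nat -> nat).
Hypotheses (n0 : 0 < n) (nB : n + 2 <= B) (WB : W <= B) (wB : forall i, wt i <= B).
Hypothesis BX : 16 * (B * B) < X.

Definition prefix_sum m := \sum_(i < m) wt i.
Definition prefix_max m := \max_(i < m) wt i.
Definition prefix_len m := \max_(k < m.+1 | prefix_sum k <= W) k.

Lemma prefix_sum_bound m : m <= n -> prefix_sum m <= B * B.
Proof.
move=> mn; apply: (@leq_trans (\sum_(i < m) B)); first exact: leq_sum.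
by rewrite sum_nat_const card_ord leq_mul2r; lia.
Qed.

Lemma prefix_max_bound m : prefix_max m <= B.
Proof. exact/bigmax_leqP. Qed.

Lemma prefix_len_bound m : prefix_len m <= m.
Proof. by apply/bigmax_leqP => k _; rewrite -ltnS. Qed.

Lemma prefix_lenS m : prefix_len m.+1 =
  prefix_len m + (1 - (W < prefix_sum m.+1)) * (m + 1 - prefix_len m).
Proof.
have := prefix_len_bound m; rewrite [prefix_len m.+1]/prefix_len.
rewrite big_mkcond big_ord_recr -big_mkcond /= -/(prefix_len m).
rewrite [prefix_sum _ <= _]leqNgt; move: (prefix_len m) => k km.
by case: (W < _) => /=; rewrite ?maxn0 ?mul0n ?addn0 //; rewrite /maxn; case: ltnP; lia.
Qed.

Definition scan_inv i s : Prop :=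
  [/\ [/\ reg s 0 = n, reg s 1 = W, reg s 2 = 0 & reg s 3 = i],
      [/\ reg s 4 = prefix_sum i, reg s 5 = prefix_len i & reg s 6 = prefix_max i],
      arr s 0 =1 wt,
      forall x, x <= i -> arr s 4 x = bitlen x &
      [/\ arr s 5 =1 (fun=> 0), arr s 6 =1 (fun=> 0) & arr s 7 =1 (fun=> 0)]].

Lemma scan_step i s : i < n -> scan_inv i s -> runs X scan_body s 100 (scan_inv i.+1).
Proof.
move=> iN [[r0 r1 r2 r3] [r4 r5 r6] a0 a4 [a5 a6 a7]].
have hS := prefix_sum_bound iN; have hM := prefix_max_bound i.
have hL := prefix_len_bound i; have hw := wB i.
have SE : prefix_sum i.+1 = prefix_sum i + wt i by rewrite /prefix_sum big_ord_recr.
have ME : prefix_max i.+1 = prefix_max i + (wt i - prefix_max i).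
  by rewrite /prefix_max big_ord_recr /= maxnE.
have LE := prefix_lenS i.
have BE : bitlen (i + 1) = bitlen ((i + 1) %/ 2) + 1.
  by rewrite addn1 bitlen_half // addn1.
have hb := bitlen_le ((i + 1) %/ 2).
have h2 : (i + 1) %/ 2 <= i by lia.
have BB : 3 * B <= B * B by rewrite leq_mul2r; lia.
apply: (@runs_weaken _ _ _ _ _ (scan_inv i.+1)); first apply: (runs_assign_seq (v := prefix_max i.+1)).
- rewrite /= r3 r6 a0; lia.
- by rewrite /= r3 r6 a0 ME.
- apply: (runs_write_seq (k := i.+1) (v := bitlen i.+1)).
  + by rewrite /= r3; lia.
  + by rewrite /= r3 a4 //; lia.
  + by rewrite /= r3 addn1.
  + by rewrite /= r3 a4 // -BE addn1.
  apply: (runs_assign_seq (v := prefix_sum i.+1)).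
  + by rewrite /= r3 r4 a0; lia.
  + by rewrite /= r3 r4 a0 SE.
  apply: (runs_assign_seq (v := prefix_len i.+1)).
  + rewrite /= r1 r3 r5 -LE; have := prefix_len_bound i.+1.
    by have := leq_b1 (W < prefix_sum i.+1); nia.
  + by rewrite /= r1 r3 r5 -LE.
  apply: runs_assign; first by rewrite /= r3; lia.
  rewrite /= r3 addn1; split=> //=.
  move=> x; rewrite leq_eqVlt => /predU1P[->|xi]; first by rewrite eqxx.
  by rewrite ltn_eqF //= a4.
- by [].
by [].
Qed.

Lemma scan_runs s : scan_inv 0 s -> runs X scan s (104 * n + 4) (scan_inv n).
Proof.
have BB : 3 * B <= B * B by rewrite leq_mul2r; lia.
move=> h; apply: (@runs_while X _ _ s 100 n scan_inv) h.
  move=> i s' iN hI; split; last exact: scan_step.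
    by case: hI => -[r0 _ _ r3] _ _ _ _; rewrite /= r0 r3 iN; lia.
  by case: hI => -[r0 _ _ r3] _ _ _ _; rewrite /= r0 r3 iN.
move=> s' [[r0 _ _ r3] _ _ _ _]; rewrite /= r0 r3 ltnn; split=> //; lia.
Qed.

Section Classify.
Variables (t c : nat).
Hypotheses (tn : t <= n) (cX : c < X).

Local Notation copies := (copies t wt).
Local Notation reached := (reached t wt).
Local Notation class := (class n t wt).
Local Notation classes := (classes n t wt).
Local Notation firsts := (firsts n t wt).
Local Notation slot := (slot n t wt).
Local Notation bound := (bound t c wt).
Local Notation wkey := (wkey t wt).
Local Notation lkey := (lkey t wt).
Local Notation item := (item t).
Local Notation side := (side t).

Definition classify_inv i s : Prop :=
  [/\ [/\ reg s 0 = n, reg s 2 = size (firsts i), reg s 3 = i, reg s 5 = t & reg s 7 = c],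
      arr s 0 =1 wt,
      forall x, x <= n -> arr s 4 x = bitlen x,
      [/\ arr s 5 =1 copies i, arr s 6 =1 reached i & arr s 7 =1 slot i] &
      (forall k, k < i -> arr s 2 (item k) = index (class k) (classes i)) /\
      (forall j, j < size (firsts i) -> arr s 3 j = bound (nth 0 (firsts i) j))].

Lemma classify_step i s : i < n -> classify_inv i s ->
  runs X classify_body s 200 (classify_inv i.+1).
Proof.
move=> iN [[r0 r2 r3 r5 r7] a0 a4 [a5 a6 a7] [a2 a3]].
have BB : 3 * B <= B * B by rewrite leq_mul2r; lia.
have s1 : side i <= 1 by rewrite /side leq_b1.
have sE : 1 - (i < t) = side i by rewrite /side ltnNge; case: (t <= i).
have iE : (i < t) * (t - 1 - i) + side i * i = item i.
  by rewrite /item /side [t <= i]leqNgt subn1; case: (i < t) => /=; rewrite ?mul1n ?mul0n ?addn0.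
have hi : item i < n by apply: item_lt.
have hw := wB (item i).
have hc : copies i (wkey i) <= i by apply: copies_le.
have cE : copies i.+1 (wkey i) = (copies i (wkey i)).+1 by rewrite copiesS eqxx addn1.
have hb1 := bitlen_le (copies i (wkey i)).
have hb2 := bitlen_le (copies i.+1 (wkey i)).
have hu : lkey i <= 2 * n + 1 by rewrite /lkey -cE; move: hb2 cE hc iN s1; clear; lia.
pose a := 2 * bitlen (copies i (wkey i)) + side i.
have rE : reached i.+1 (lkey i) = reached i (lkey i) + (1 - (a == lkey i)).
  rewrite reachedS eqxx /new_level /a /lkey eqn_add2r eqn_mul2l /=.
  by case: (_ == _).
have hr := reached_le t wt i.+1 (lkey i).
have hr' := reached_le t wt i (lkey i).
have hb3 := bitlen_le (reached i.+1 (lkey i)).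
have classE : class i = bitlen (reached i.+1 (lkey i)) * (2 * (n + 1)) + lkey i.
  by rewrite /class addn1.
have classB : class i <= 4 * (B * B).
  rewrite classE; have : bitlen (reached i.+1 (lkey i)) * (2 * (n + 1)) <= B * (2 * B).
    by apply: leq_mul; move: hb3 hr iN nB; clear; lia.
  by move: hu nB BB; clear; lia.
have hk := size_firsts_le n t wt i.
have hslot := slot_le n t wt i (class i).
have hslot' := slot_le n t wt i.+1 (class i).
have slE : slot i (class i) = 0 <-> first n t wt i.
  by rewrite firstE /slot; case: ifP.
have hk' := size_firsts_le n t wt i.+1.
pose nw : nat := slot i (class i) == 0.
have kE : size (firsts i) + nw = size (firsts i.+1).
  rewrite firstsS /nw; case: ifP => h; first by rewrite size_rcons (slE.2 h) addn1.
  by case: eqP => [/slE|]; rewrite ?h ?addn0.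
have sl'E : slot i (class i) + nw * size (firsts i.+1) = slot i.+1 (class i).
  rewrite slotS eqxx mul1n -/nw -kE /nw.
  by case: (_ == 0); rewrite ?mul1n ?addn1 ?mul0n.
have inE' : class i \in classes i.+1.
  by rewrite mem_classes iotaSr map_rcons mem_rcons mem_head.
have bE : c %/ (2 * reached i.+1 (lkey i)) = bound i by [].
have bX : bound i < X by apply: leq_ltn_trans cX; apply: leq_div.
have XB : 24 * B + 24 <= X by move: nB BB BX; clear; lia.
have nB' : n <= B by move: nB; clear; lia.
have ib : i <= B := leq_trans (ltnW iN) nB'.
have tB : t <= B := leq_trans tn nB'.
have aB : a <= 2 * B + 1 by rewrite /a; move: hb1 hc ib s1; clear; lia.
have wkB : wkey i <= 2 * B + 1 by rewrite /wkey; move: hw s1; clear; lia.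
have cB : copies i (wkey i) <= B := leq_trans hc ib.
have rB : reached i.+1 (lkey i) <= B := leq_trans hr (leq_trans iN nB').
have uB : lkey i <= 2 * B by move: hu nB; clear; lia.
have nwB : nw <= 1 by exact: leq_b1.
have fB : size (firsts i) <= B := leq_trans hk ib.
have fB' : size (firsts i.+1) <= B := leq_trans hk' (leq_trans iN nB').
have slB : slot i (class i) <= B := leq_trans hslot fB.
have slB' : slot i.+1 (class i) <= B := leq_trans hslot' fB'.
have lt1 : ((i < t) : nat) <= 1 by exact: leq_b1.
have eq1 : ((a == lkey i) : nat) <= 1 by exact: leq_b1.
have [k' k'E] : exists k', k' = size (firsts i.+1) by exists (size (firsts i.+1)).
rewrite -k'E in kE sl'E fB'.
have [v2 v2E] : exists v, v = index (class i) (classes i.+1).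
  by exists (index (class i) (classes i.+1)).
have clS := classesS n t wt i; have fS := firstsS n t wt i.
have cS := copiesS t wt i; have rS := reachedS t wt i; have sS := slotS n t wt i.
apply: (@runs_weaken _ _ _ _ _ (classify_inv i.+1)).
- apply: (runs_assign_seq (v := side i)).
  + by rewrite /= r3 r5 sE; move: s1 lt1 ib tB XB BX; clear; lia.
  + by rewrite /= r3 r5 sE.
  apply: (runs_assign_seq (v := item i)).
  + rewrite /= r3 r5 iE.
    have m1 : (i < t) * (t - 1 - i) <= t.
      by case: (i < t); rewrite ?mul1n ?mul0n // -subnDA leq_subr.
    have m2 : side i * i <= i by rewrite -[leqRHS]mul1n leq_mul2r s1 orbT.
    by move: s1 m1 m2 lt1 hi ib tB nB XB BX; clear; lia.
  + by rewrite /= r3 r5 iE.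
  apply: (runs_assign_seq (v := wkey i)).
  + by rewrite /= a0; move: s1 hw hi nB XB BX; clear; lia.
  + by rewrite /= a0.
  apply: (runs_assign_seq (v := a)).
  + rewrite /= a5 a4; last by move: hc iN; clear; lia.
    by move: aB hb1 cB s1 wkB XB BX; rewrite /a; clear; lia.
  + by rewrite /= a5 a4 //; move: hc iN; clear; lia.
  apply: (runs_write_seq (k := wkey i) (v := copies i.+1 (wkey i))).
  + by rewrite /=; move: wkB XB BX; clear; lia.
  + by rewrite /= a5; move: wkB cB XB BX; clear; lia.
  + by [].
  + by rewrite /= a5 cE addn1.
  apply: (runs_assign_seq (v := lkey i)).
  + rewrite /= eqxx /= a4; last by move: cE hc iN; clear; lia.
    by move: uB hb2 cE cB s1 wkB XB BX; clear; lia.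
  + by rewrite /= eqxx /= a4 /lkey -?cE //; move: cE hc iN; clear; lia.
  apply: (runs_write_seq (k := lkey i) (v := reached i.+1 (lkey i))).
  + by rewrite /=; move: uB XB BX; clear; lia.
  + by rewrite /= a6 -rE; move: eq1 hr' ib uB aB rB XB BX; clear; lia.
  + by [].
  + by rewrite /= a6 rE.
  apply: (runs_assign_seq (v := class i)).
  + rewrite /= eqxx /= a4 ?r0; last by move: hr iN; clear; lia.
    rewrite -classE; have := classE; move: (_ * (2 * _)) => q qE.
    by move: qE classB hb3 uB rB nB XB BX; clear; lia.
  + by rewrite /= eqxx /= a4 ?r0 ?classE //; move: hr iN; clear; lia.
  apply: (runs_assign_seq (v := nw)).
  + by rewrite /= a7 -/nw; move: nwB slB classB XB BX; clear; lia.
  + by rewrite /= a7.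
  apply: (runs_write_seq (k := size (firsts i)) (v := bound i)).
  + by rewrite /= r2; move: fB XB BX; clear; lia.
  + by rewrite /= eqxx /= r7 bE bX cX; move: rB uB XB BX; clear; lia.
  + by rewrite /= r2.
  + by rewrite /= eqxx /= r7.
  apply: (runs_assign_seq (v := k')).
  + by rewrite /= r2 kE; move: nwB fB fB' XB BX; clear; lia.
  + by rewrite /= r2 kE.
  apply: (runs_write_seq (k := class i) (v := slot i.+1 (class i))).
  + by rewrite /=; move: classB XB BX; clear; lia.
  + rewrite /= a7 sl'E; have : nw * k' <= B.
      by apply: leq_trans fB'; rewrite -[leqRHS]mul1n leq_mul2r nwB orbT.
    by move: nwB fB' slB slB' classB XB BX; clear; lia.
  + by [].
  + by rewrite /= a7 sl'E.
  apply: (runs_write_seq (k := item i) (v := v2)).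
  + by rewrite /=; move: hi nB XB BX; clear; lia.
  + by rewrite /= eqxx /=; move: slB' classB XB BX; clear; lia.
  + by [].
  + by rewrite /= eqxx /= /slot inE' subn1 v2E.
  apply: runs_assign; first by rewrite /= r3; move: ib XB BX; clear; lia.
  rewrite /= r3 addn1 /classify_inv; move: v2E k'E inE' clS fS cS rS sS.
  move: (copies i.+1) (reached i.+1) (slot i.+1) (classes i.+1) (firsts i.+1).
  move=> c1 q1 l1 cl1 f1 v2E k'E inE' clS fS cS rS sS.
  split=> //=.
  + split=> // x.
    * by rewrite a5; case: eqVneq => [->//|xu]; rewrite cS [wkey i == x]eq_sym (negPf xu) addn0.
    * by rewrite a6; case: eqVneq => [->//|xu]; rewrite rS [lkey i == x]eq_sym (negPf xu) addn0.
    * by rewrite a7; case: eqVneq => [->//|xu]; rewrite sS (negPf xu) !mul0n addn0.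
  split.
  + move=> k; rewrite ltnS leq_eqVlt => /predU1P[->|ki]; first by rewrite eqxx.
    have -> : (item k == item i) = false.
      by apply/negP => /eqP /(can_inj (itemK t)) E; rewrite E ltnn in ki.
    rewrite a2 // clS; case: ifP => // _; rewrite -cats1 index_cat mem_classes map_f //.
    by rewrite mem_iota.
  (* Entry [size (firsts i)] has been overwritten; it is in the valid range only if [i] starts a
     class, and then [bound i] is right. *)
  + move=> j; rewrite -k'E -kE /nw => jk.
    have [f|nf] := boolP (first n t wt i).
      rewrite fS f nth_rcons; move: jk; rewrite (slE.2 f) addn1 ltnS leq_eqVlt.
      case/predU1P => [->|jl]; first by rewrite eqxx ltnn.
      by rewrite jl ltn_eqF // a3.
    move: jk; have -> : (slot i (class i) == 0) = false by apply/eqP => /slE; apply/negP.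
    by rewrite addn0 => jl; rewrite ltn_eqF // a3 // fS (negPf nf).
- by [].
by [].
Qed.

Lemma classify_runs s :
  classify_inv 0 s -> runs X classify s (204 * n + 4) (classify_inv n).
Proof.
have BB : 3 * B <= B * B by rewrite leq_mul2r; lia.
move=> h; apply: (@runs_while X _ _ s 200 n classify_inv) h.
  move=> i s' iN hI; split; last exact: classify_step.
    by case: hI => -[r0 _ r3 _ _] _ _ _ _; rewrite /= r0 r3 iN; move: iN nB BB BX; clear; lia.
  by case: hI => -[r0 _ r3 _ _] _ _ _ _; rewrite /= r0 r3 iN.
move=> s' [[r0 _ r3 _ _] _ _ _ _]; rewrite /= r0 r3 ltnn; split=> //.
by move: nB BB BX; clear; lia.
Qed.
End Classify.
End Execution.

Section Algorithm.
Variables (n : nat) (w p : 'I_n -> nat) (W : nat).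
Hypotheses (n0 : 0 < n) (w0 : forall i, 0 < w i).

Definition array_of (f : 'I_n -> nat) (i : nat) : nat := oapp f 0 (insub i).

Lemma array_ofE f (i : 'I_n) : array_of f i = f i.
Proof. by rewrite /array_of valK. Qed.

Let B := n + W + \max_i w i + \max_i p i + 2.
Let wt := array_of w.
Let t := prefix_length w W.

Lemma prefix_sumE m : m <= n -> prefix_sum wt m = \sum_(i < n | i < m) w i.
Proof.
move=> mn; rewrite /prefix_sum (big_ord_widen n wt mn).
by apply: eq_bigr => i _; rewrite /wt array_ofE.
Qed.

Lemma prefix_lenE : prefix_len W wt n = t.
Proof. by apply: eq_bigl => m; rewrite prefix_sumE // -ltnS. Qed.

Lemma prefix_maxE : prefix_max wt n = max_weight w.
Proof. by apply: eq_bigr => i _; rewrite /wt array_ofE. Qed.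

Lemma prefix_length_le : t <= n.
Proof. by rewrite -prefix_lenE prefix_len_bound. Qed.

Definition bound_numerator (a b : nat) : nat :=
  a * b * b * bitlen n * bitlen n * bitlen n * max_weight w * max_weight w.

Let mul_bound x y a b : x <= B ^ a -> y <= B ^ b -> x * y <= B ^ (a + b).
Proof. by rewrite expnD; apply: leq_mul. Qed.

Lemma runs_scan_classify a b :
  a <= 4 ^ 5 -> b <= 4 ^ 5 ->
  runs (word_bound 21 w p W) (Seq scan (Seq (numerator a b) classify))
    (input_state w p W) (400 * n) (classify_inv n wt t (bound_numerator a b) n).
Proof.
move=> a5 b5; have B4 : 4 <= B.
  have := max_weight_gt0 n0 w0; rewrite /max_weight /B.
  by move: n0; clear; lia.
have nB : n + 2 <= B by rewrite /B; clear; lia.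
have WB : W <= B by rewrite /B; clear; lia.
have MB : max_weight w <= B by rewrite /B /max_weight; clear; lia.
have wB i : wt i <= B.
  rewrite /wt /array_of; case: insubP => //= u _ _.
  exact: leq_trans (le_max_weight w u) MB.
have LB : bitlen n <= B by apply: leq_trans (bitlen_le n) _; move: nB; clear; lia.
have B1 : 1 < B by apply: leq_trans B4.
(* Each of the three constant factors is at most [B ^ 5] and each of the other five at most [B], so
   the numerator is at most [B ^ 20]. *)
have B5 : 4 ^ 5 <= B ^ 5 by rewrite leq_exp2r.
have {a5} ka : a <= B ^ 5 by apply: leq_trans B5.
have {b5} kb : b <= B ^ 5 by apply: leq_trans B5.
have lt_X e x : e <= 20 -> x <= B ^ e -> x < word_bound 21 w p W.
  by move=> e20 /leq_ltn_trans; apply; rewrite ltn_exp2l.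
move: (word_bound 21 w p W) lt_X => X lt_X.
have BX : 16 * (B * B) < X.
  apply: (lt_X 4) => //; rewrite (expnD B 2 2) -mulnn leq_mul2r; apply/orP; right.
  by rewrite -[16]/(4 * 4); apply: leq_mul.
have L1 : bitlen n <= B ^ 1 by rewrite expn1.
have M1 : max_weight w <= B ^ 1 by rewrite expn1.
have h1 := mul_bound ka kb.
have h2 := mul_bound h1 kb.
have h3 := mul_bound h2 L1.
have h4 := mul_bound h3 L1.
have h5 := mul_bound h4 L1.
have h6 := mul_bound h5 M1.
have h7 := mul_bound h6 M1.
have cX : bound_numerator a b < X by apply: lt_X h7.
have nX : n < X by apply: (lt_X 1); rewrite // expn1; move: nB; clear; lia.
apply: (@runs_weaken _ _ _ _ _ (classify_inv n wt t (bound_numerator a b) n)).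
- apply: runs_seq.
    apply: (scan_runs n0 nB WB wB BX).
    split=> //; last by case.
    rewrite /prefix_sum /prefix_max !big_ord0; split=> //=.
    by apply/eqP; rewrite eq_sym -leqn0 prefix_len_bound.
  move=> s1 [[r0 r1 r2 r3] [r4 r5 r6] a0 a4 [a5 a6 a7]].
  apply: runs_seq.
    apply: (@runs_assign_seq _ 7 _ (bound_numerator a b)).
    + rewrite /= r0 r6 a4 // prefix_maxE nX.
      rewrite (lt_X _ _ _ h1) // (lt_X _ _ _ h2) // (lt_X _ _ _ h3) //.
      rewrite (lt_X _ _ _ h4) // (lt_X _ _ _ h5) // (lt_X _ _ _ h6) //.
      rewrite (lt_X _ _ _ h7) // (lt_X _ _ _ ka) // (lt_X _ _ _ kb) //.
      by rewrite (lt_X _ _ _ L1) // (lt_X _ _ _ M1).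
    + by rewrite /= r0 r6 a4 // prefix_maxE.
    apply: (@runs_assign _ _ _ _ (classify_inv n wt t (bound_numerator a b) 0)).
      by rewrite /= andbT; apply: leq_ltn_trans BX.
    split=> //=.
      by split=> //=; rewrite r5 prefix_lenE.
  move=> s2 hI.
  exact: (classify_runs n0 nB WB wB BX prefix_length_le cX hI).
- by move: n0; rewrite /=; clear; lia.
by [].
Qed.
End Algorithm.

(** * Structure of the classes *)

Section Levels.
Variables (n t : nat) (wt : nat -> nat).
Hypothesis tn : t <= n.

Local Notation copies := (copies t wt).
Local Notation reached := (reached t wt).
Local Notation class := (class n t wt).
Local Notation classes := (classes n t wt).
Local Notation firsts := (firsts n t wt).
Local Notation first := (first n t wt).
Local Notation wkey := (wkey t wt).
Local Notation lkey := (lkey t wt).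
Local Notation new_level := (new_level t wt).
Local Notation item := (item t).
Local Notation side := (side t).

Lemma leq_copies v : {homo copies^~ v : k l / k <= l}.
Proof.
by move=> k l kl; rewrite /copies -(subnKC kl) iotaD count_cat leq_addr.
Qed.

Lemma side_le1 k : side k <= 1.
Proof. exact: leq_b1. Qed.

Lemma wkey_inj j k : wkey j = wkey k -> wt (item j) = wt (item k) /\ side j = side k.
Proof. by have := side_le1 j; have := side_le1 k; rewrite /wkey; clear; lia. Qed.

Lemma lkey_inj j k : lkey j = lkey k ->
  bitlen (copies j.+1 (wkey j)) = bitlen (copies k.+1 (wkey k)) /\ side j = side k.
Proof.
have := side_le1 j; have := side_le1 k; rewrite /lkey !copiesS !eqxx !addn1.
by clear; lia.
Qed.

(** [j] is the first time at which the weight of item [k] reaches the level that it has at [k]. *)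
Lemma enters_level k :
  exists j, [/\ j <= k, wkey j = wkey k, lkey j = lkey k & new_level j].
Proof.
pose v := wkey k; pose b := bitlen (copies k.+1 v).
have exj : exists j, b <= bitlen (copies j.+1 v) by exists k.
case: (ex_minnP exj) => j bj jmin; have jk : j <= k by exact: jmin.
have b0 : 0 < b by rewrite /b copiesS eqxx addn1.
have jb : bitlen (copies j v) < b.
  case: (j) jmin => [|i] imin; first by [].
  by rewrite ltnNge; apply/negP => /imin; rewrite ltnn.
have jv : wkey j = v.
  by apply/eqP; move: (leq_trans jb bj); rewrite copiesS; case: eqP => //; rewrite addn0 ltnn.
have cj : copies j.+1 (wkey j) = (copies j (wkey j)).+1 by rewrite copiesS eqxx addn1.
have ck : copies k.+1 (wkey k) = (copies k (wkey k)).+1 by rewrite copiesS eqxx addn1.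
have bE : bitlen (copies j.+1 v) = b.
  by apply/eqP; rewrite eqn_leq bj leq_bitlen // leq_copies.
exists j; split=> //.
- by rewrite /lkey -cj -ck jv bE; have [_ ->] := wkey_inj jv.
- by rewrite /new_level -cj jv bE ltn_eqF.
Qed.

(** If [j < k], the weight would have that level already before [k], as copies only accumulate. *)
Lemma enters_level_once j k :
  wkey j = wkey k -> lkey j = lkey k -> new_level k -> k <= j.
Proof.
move=> wjk /lkey_inj[bE _] nk; rewrite leqNgt; apply/negP => jk.
move/negP: nk; apply; rewrite eqn_leq leq_bitlen // andTb.
have -> : (copies k (wkey k)).+1 = copies k.+1 (wkey k) by rewrite copiesS eqxx addn1.
by rewrite -bE wjk leq_bitlen // leq_copies.
Qed.

(** The weights behind the count [reached]; they will be the frequent values in the proximity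
    bound. *)
Definition level_weights k u :=
  [seq wt (item j) | j <- iota 0 k & (lkey j == u) && new_level j].

Lemma size_level_weights k u : size (level_weights k u) = reached k u.
Proof. by rewrite size_map size_filter. Qed.

Lemma uniq_level_weights k u : uniq (level_weights k u).
Proof.
rewrite map_inj_in_uniq ?filter_uniq ?iota_uniq // => i j.
rewrite !mem_filter => /andP[/andP[/eqP iu ni] _] /andP[/andP[/eqP ju nj] _] wij.
have lij : lkey i = lkey j by rewrite iu ju.
have wk : wkey i = wkey j by rewrite /wkey wij; have [_ ->] := lkey_inj lij.
by apply/eqP; rewrite eqn_leq !enters_level_once.
Qed.

Lemma mem_level_weights j k u :
  j < k -> lkey j = u -> wt (item j) \in level_weights k u.
Proof.
move=> jk <-; have [i [ij wij lij ni]] := enters_level j.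
have [<- _] := wkey_inj wij; apply: map_f.
by rewrite mem_filter mem_iota lij eqxx ni (leq_ltn_trans ij jk).
Qed.

Lemma reached_gt0 k : 0 < reached k.+1 (lkey k).
Proof.
rewrite -size_level_weights; have := @mem_level_weights k k.+1 _ (ltnSn k) erefl.
by case: (level_weights _ _).
Qed.

Lemma lkey_lt k : k < n -> lkey k < 2 * n.+1.
Proof.
move=> kn; have := bitlen_le (copies k (wkey k)).+1; have := copies_le t wt k (wkey k).
by move: kn (side_le1 k); rewrite /lkey; clear; lia.
Qed.

Lemma class_inj j k : j < n -> k < n -> class j = class k ->
  lkey j = lkey k /\ bitlen (reached j.+1 (lkey j)) = bitlen (reached k.+1 (lkey k)).
Proof.
move=> /lkey_lt jn /lkey_lt kn E; have l : lkey j = lkey k.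
  by move/(congr1 (modn^~ (2 * n.+1))): E; rewrite !modnMDl !modn_small.
by split=> //; move: E; rewrite /class l => /addIn/eqP; rewrite eqn_pmul2r // => /eqP.
Qed.

Lemma uniq_classes k : uniq (classes k).
Proof.
elim: k => // k IH; rewrite classesS; case: ifP => //; rewrite firstE rcons_uniq => ->.
by rewrite IH.
Qed.

(** Both numbers have the same binary length. *)
Lemma reached_lt_double j k : j < n -> k < n -> class j = class k ->
  reached j.+1 (lkey j) <= 2 * reached k.+1 (lkey k).
Proof.
move=> jn kn /(class_inj jn kn)[_ bE]; have /andP[_ h1] := bitlenP (reached_gt0 j).
have /andP[h2 _] := bitlenP (reached_gt0 k); apply: leq_trans (ltnW h1) _.
rewrite bE; case: (bitlen _) h2 => [|b] h2; last by rewrite expnS leq_mul2l.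
by rewrite expn0 muln_gt0 reached_gt0.
Qed.

Lemma item_lt_prefix k : (item k < t) = (k < t).
Proof.
rewrite /item; case: (ltnP k t) => // h; last by rewrite ltnNge h.
by move: h; clear; lia.
Qed.

Lemma copies_inj j k : wkey j = wkey k ->
  copies j (wkey j) = copies k (wkey k) -> j = k.
Proof.
wlog jk : j k / j <= k => [h|].
  by case/orP: (leq_total j k) => [/h //|/h h' E1 E2]; apply/esym/h'.
move: jk; rewrite leq_eqVlt => /predU1P[//|jk] wE cE.
have := leq_copies (wkey j) jk; rewrite copiesS eqxx addn1 cE wE.
by rewrite ltnn.
Qed.

(** Items of equal weight in one class differ in the number of earlier copies. With the item itself
    included, this number has [b] binary digits, which leaves [2 ^ b.-1] possibilities. *)
Lemma class_multiplicity j v : j < n ->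
  count (fun k => (class k == class j) && (wt (item k) == v)) (iota 0 n) <=
  2 ^ (bitlen (copies j.+1 (wkey j))).-1.
Proof.
move=> jn; set b := bitlen _; rewrite -size_filter.
set s := filter _ _; rewrite -[leqRHS](size_iota (2 ^ b.-1).-1).
rewrite -(size_map (fun k => copies k (wkey k))).
have hs k : k \in s -> [/\ k < n, lkey k = lkey j & wt (item k) = v].
  rewrite mem_filter mem_iota => /andP[/andP[/eqP cE /eqP wE] kn]; split=> //.
  by have [] := class_inj kn jn cE.
apply: uniq_leq_size.
  rewrite map_inj_in_uniq ?filter_uniq ?iota_uniq // => i k.
  move=> /hs[_ li wi] /hs[_ lk wk]; apply: copies_inj.
  have [_ sE] : _ := @lkey_inj i k (etrans li (esym lk)).
  by rewrite /wkey wi wk sE.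
move=> _ /mapP[k /hs[kn lk _] ->]; have [bE _] := lkey_inj lk.
rewrite copiesS eqxx addn1 -/b in bE.
have /andP[h1 h2] := @bitlenP (copies k (wkey k)).+1 isT.
rewrite bE in h1 h2; rewrite mem_iota.
have b0 : 0 < b by rewrite -bE.
move: h2; rewrite -{1}(prednK b0) expnS; move: h1.
by have : 0 < 2 ^ b.-1; [rewrite expn_gt0 | clear; lia].
Qed.

Lemma size_firsts_bound :
  0 < n -> size (firsts n) <= (bitlen n).+1 * (2 * (bitlen n).+1).
Proof.
move=> n0; rewrite -(size_classes n t wt).
pose S := [seq a * (2 * n.+1) + u | a <- iota 0 (bitlen n).+1, u <- iota 0 (2 * (bitlen n).+1)].
have -> : (bitlen n).+1 * (2 * (bitlen n).+1) = size S by rewrite size_allpairs !size_iota.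
apply: uniq_leq_size (uniq_classes n) _ => a; rewrite mem_classes => /mapP[k].
rewrite mem_iota => /= kn ->; apply/allpairsP.
exists (bitlen (reached k.+1 (lkey k)), lkey k); split=> //; rewrite mem_iota leq0n add0n andTb [X in X < _]/=.
  rewrite ltnS; apply: leq_bitlen; exact: leq_trans (reached_le _ _ _ _) kn.
have h := leq_bitlen (leq_trans (copies_le t wt k.+1 (wkey k)) kn).
move: (side_le1 k) h; rewrite /lkey copiesS eqxx addn1 add0n; clear; lia.
Qed.

Lemma card_item (P : pred nat) :
  #|[set i : 'I_n | P (item i)]| = count P (iota 0 n).
Proof.
have lt (i : 'I_n) : item i < n by apply: item_lt.
have -> : iota 0 n = index_iota 0 n by rewrite /index_iota subn0.
rewrite -sum1_card -[RHS]sum1_count big_mkord.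
rewrite (reindex_inj (h := fun i => Ordinal (lt i))); last first.
  by move=> i j /(congr1 val) /= /(can_inj (itemK t)) /val_inj.
by apply: eq_bigl => i; rewrite inE /= itemK.
Qed.
End Levels.

(** * Proximity bounds of the parts *)

Section PartProximity.
Variables (n : nat) (w p : 'I_n -> nat) (W c : nat) (x : {ffun 'I_n -> bool}).
Hypotheses (n0 : 0 < n) (w0 : forall i, 0 < w i).
Hypothesis ratio : forall i j : 'I_n, i < j -> p j * w i < p i * w j.
Hypothesis cE : c = 300 * (1000 * (1000 * (trunc_log 2 (2 * n) ^ 3 * max_weight w ^ 2))).

Local Notation t := (prefix_length w W).
Local Notation wt := (array_of w).
Local Notation reached := (reached t wt).
Local Notation copies := (copies t wt).
Local Notation class := (class n t wt).
Local Notation wkey := (wkey t wt).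
Local Notation lkey := (lkey t wt).
Local Notation item := (item t).
Local Notation side := (side t).
Local Notation bound := (bound t c wt).

Let tn : t <= n. Proof. exact: prefix_length_le. Qed.

Variable k0 : nat.
Hypotheses (k0n : k0 < n) (k0f : first n t wt k0).

Let I := [set i : 'I_n | class (item i) == class k0].
Let V := level_weights t wt k0.+1 (lkey k0).

Let item_n (i : 'I_n) : item i < n. Proof. exact: item_lt. Qed.

Let wt_item (i : 'I_n) : wt (item (item i)) = w i.
Proof. by rewrite itemK array_ofE. Qed.

Let size_V : size V = reached k0.+1 (lkey k0).
Proof. exact: size_level_weights. Qed.

Let size_V0 : 0 < size V.
Proof. by rewrite size_V reached_gt0. Qed.

(** By the last item of the class all its weights have reached the level, and the number of such
    weights has at most doubled since the first item. *)
Lemma size_supp_part : size (supp_weights w I) <= 2 * size V.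
Proof.
have exk : exists k, (k < n) && (class k == class k0) by exists k0; rewrite k0n eqxx.
have bk k : (k < n) && (class k == class k0) -> k <= n by case/andP=> /ltnW.
case: (ex_maxnP exk bk) => k /andP[kn /eqP kc] kmax.
rewrite size_V; apply: leq_trans (reached_lt_double kn k0n kc).
rewrite -size_level_weights; apply: uniq_leq_size (undup_uniq _) _ => v.
rewrite mem_undup => /imageP[i]; rewrite inE => /eqP ic ->.
rewrite -wt_item; apply: mem_level_weights.
  by rewrite ltnS; apply: kmax; rewrite item_n ic eqxx.
by have [] := class_inj (item_n i) kn (etrans ic (esym kc)).
Qed.

Lemma part_multiplicity v :
  #|[set i in I | w i == v]| <= 2 ^ (bitlen (copies k0.+1 (wkey k0))).-1.
Proof.
apply: leq_trans (@class_multiplicity n t wt k0 v k0n); rewrite -(card_item tn).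
by apply/subset_leq_card/subsetP => i; rewrite !inE wt_item.
Qed.

(** The copies that lifted a weight of [V] to the level of [k0] all lie on the side of [k0] and come
    no later than [k0]. *)
Lemma near_multiplicity v : v \in V ->
  2 ^ (bitlen (copies k0.+1 (wkey k0))).-1 <=
  #|[set i in [set i : 'I_n | (item i <= k0) && (side (item i) == side k0)] | w i == v]|.
Proof.
case/mapP=> j; rewrite mem_filter mem_iota add0n => /andP[/andP[/eqP lj _]].
rewrite leq0n andTb => jk ->.
have [<- sj] := lkey_inj lj.
apply: (@leq_trans (copies k0.+1 (wkey j))).
  apply: leq_trans (leq_copies _ _ _ jk).
  have c0 : 0 < copies j.+1 (wkey j) by rewrite copiesS eqxx addn1.
  by have /andP[] := bitlenP c0.
have -> : [set i in [set i : 'I_n | (item i <= k0) && (side (item i) == side k0)]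
    | w i == wt (item j)] = [set i : 'I_n | [pred k | [&& k <= k0, side k == side k0
      & wt (item k) == wt (item j)]] (item i)].
  by apply/setP=> i; rewrite !inE wt_item andbA.
rewrite card_item // -[X in iota 0 X](subnKC k0n) iotaD count_cat.
apply: leq_trans (leq_addr _ _).
rewrite /copies -!size_filter; apply: uniq_leq_size; first by rewrite filter_uniq ?iota_uniq.
move=> k; rewrite !mem_filter => /andP[/eqP /wkey_inj[wk sk] kk0].
by rewrite kk0 andbT /= wk sk sj !eqxx !andbT; rewrite mem_iota ltnS in kk0.
Qed.

Lemma part_after (i : 'I_n) : i \in I -> k0 <= item i.
Proof.
rewrite inE leqNgt => /eqP ic; apply: contraL k0f => ik.
by rewrite negbK -ic map_f // mem_iota.
Qed.

Lemma part_proximity : optimal w p W x ->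
  \sum_(i in I) w i * `|max_prefix w W i - x i|%N <= bound k0.
Proof.
move=> optx; rewrite /bound -size_V leq_divRL ?muln_gt0 // mulnC cE.
have i0E : item (item k0) = k0 by rewrite itemK.
pose i0 := Ordinal (item_lt tn k0n).
apply: (@part_bound _ w p W x n0 w0 ratio optx _ I i0 V
  (2 ^ (bitlen (copies k0.+1 (wkey k0))).-1)) => //.
- exact: uniq_level_weights.
- by rewrite expn_gt0.
- exact: near_multiplicity.
- by rewrite inE /= itemK.
- exact: size_supp_part.
- exact: part_multiplicity.
have sI (i : 'I_n) : i \in I -> side (item i) = side k0.
  rewrite inE => /eqP /(class_inj (item_n i) k0n)[h _].
  by have [] := lkey_inj h.
have lt_t (i : 'I_n) : (i < t) = (item i < t) by rewrite item_lt_prefix.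
have IF (i : 'I_n) : i \in I :\ i0 -> k0 < item i.
  rewrite in_setD1 => /andP[ii0 iI]; rewrite ltn_neqAle part_after // andbT.
  by apply: contra ii0 => /eqP ik; apply/eqP/val_inj; rewrite /= ik itemK.
have iE (i : 'I_n) : (i : nat) = if item i < t then t.-1 - item i else item i.
  exact: esym (itemK t i).
have sN (i : 'I_n) : i \in [set i : 'I_n | (item i <= k0) && (side (item i) == side k0)] ->
    item i <= k0 /\ side (item i) = side k0.
  by rewrite inE => /andP[? /eqP].
have sideE k : side k = ~~ (k < t) by rewrite /side leqNgt.
have sb k l : side k = side l -> (k < t) = (l < t).
  by rewrite !sideE; case: (k < t); case: (l < t).
(* On the left a farther item has a smaller index, on the right a larger one. *)
have [k0t|tk0] := ltnP k0 t; [left | right].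
  split=> [i /sN[_ /sb]|i /sI/sb|i j iI]; rewrite ?lt_t; try by move=> ->.
  move=> jN; have [jk /sb jt] := sN j jN; have ik := IF i iI.
  have it : item i < t by move: iI; rewrite in_setD1 => /andP[_ /sI/sb ->].
  have iv := iE i; have jv := iE j; rewrite it in iv; rewrite jt k0t in jv.
  by move: iv jv ik jk it; clear; lia.
have nt (i : 'I_n) : side (item i) = side k0 -> t <= i.
  by move=> /sb h; rewrite leqNgt lt_t h -leqNgt.
split=> [i /sN[_ /nt]|i /sI/nt|i j iN jI] //.
have [ik /sb it] := sN i iN; have jk := IF j jI.
have jt : (item j < t) = (k0 < t) by move: jI; rewrite in_setD1 => /andP[_ /sI/sb].
have k0t : (k0 < t) = false by rewrite ltnNge tk0.
have iv := iE i; have jv := iE j; rewrite it k0t in iv; rewrite jt k0t in jv.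
by rewrite iv jv; apply: leq_ltn_trans ik jk.
Qed.

Lemma part_supp_bound : size (supp_weights w I) * bound k0 <= c.
Proof.
apply: leq_trans (_ : (2 * size V) * bound k0 <= c); first by rewrite leq_mul2r size_supp_part orbT.
by rewrite /bound size_V mulnC leq_divM.
Qed.
End PartProximity.

(** * Passage to real bounds and conclusion *)

Lemma ratio_nat (a b c d : nat) : 0 < b -> 0 < d ->
  (a%:Q / b%:Q < c%:Q / d%:Q)%R -> a * d < c * b.
Proof.
move=> b0 d0; rewrite ltr_pdivrMr ?ltr0z // mulrAC ltr_pdivlMr ?ltr0z //.
by rewrite -!intrM ltr_int -!PoszM ltz_nat.
Qed.

Lemma bitlenE n : 0 < n -> bitlen n = trunc_log 2 (2 * n).
Proof. by case: n => // n _; rewrite mul2n trunc_log2_double. Qed.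

Lemma bound_numeratorE n (w : 'I_n -> nat) a b : 0 < n ->
  bound_numerator w a b = a * (b * (b * (trunc_log 2 (2 * n) ^ 3 * max_weight w ^ 2))).
Proof.
by move=> n0; rewrite /bound_numerator bitlenE // !expnS !expn0 !muln1 !mulnA.
Qed.

Lemma trunc_log_le_log2 (R : realType) n : 0 < n ->
  ((trunc_log 2 (2 * n))%:R <= log2 (2 * n%:R : R))%R.
Proof.
move=> n0; have ln2 : (0 < ln 2 :> R)%R by rewrite ln_gt0 // ltr1n.
rewrite /log2 ler_pdivlMr // [leLHS]mulr_natl -lnXn // ler_ln ?posrE ?exprn_gt0 ?mulr_gt0 ?ltr0n //.
by rewrite -natrX -natrM ler_nat trunc_logP // muln_gt0.
Qed.

(** No fibre is empty, which makes the fibres distinct and admissible as blocks. *)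
Lemma partition_fibers (T : finType) k (f : T -> 'I_k) :
  (forall j, exists i, f i = j) ->
  injective (fun j => [set i | f i == j]) /\
  partition [set [set i | f i == j] | j : 'I_k] [set: T].
Proof.
move=> fsurj; split.
  move=> j j' /setP E; have [i fi] := fsurj j.
  by have := E i; rewrite !inE fi eqxx => /esym /eqP.
apply/and3P; split.
- apply/eqP/setP=> i; rewrite inE; apply/bigcupP.
  by exists [set i' | f i' == f i]; [apply: imset_f | rewrite inE].
- apply/trivIsetP => _ _ /imsetP[j _ ->] /imsetP[j' _ ->] jj'.
  rewrite -setI_eq0; apply: contraNT jj' => /set0Pn[i].
  by rewrite !inE => /andP[/eqP <- /eqP <-].
- apply/imsetP => -[j _ E]; have [i fi] := fsurj j.
  by have := in_set0 i; rewrite E inE fi eqxx.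
Qed.

Theorem theorem4p1 :
  exists (algo : cmd) (d C c C' : nat),
  forall (R : realType) (n : nat) (w p : 'I_n -> nat) (W : nat),
  0 < n ->
  (forall i : 'I_n, 0 < w i) ->
  (forall i j : 'I_n, i < j ->
     ((p j)%:Q / (w j)%:Q < (p i)%:Q / (w i)%:Q)%R) ->
  exists (t : nat) (s : state) (k : nat)
         (I : 'I_k -> {set 'I_n}) (Delta : 'I_k -> nat),
  [/\ exec (word_bound d w p W) algo (input_state w p W) t s,
      (t%:R <= C%:R * n%:R * log2 (2 * n%:R : R) ^+ c)%R,
      outputs s I Delta,
      injective I /\ partition [set I j | j : 'I_k] [set: 'I_n] &
      (k%:R <= C'%:R * log2 (2 * n%:R : R) ^+ 2)%R /\
      forall j : 'I_k,
        (forall x : {ffun 'I_n -> bool}, optimal w p W x ->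
           \sum_(i in I j) w i * `|max_prefix w W i - x i|%N <= Delta j) /\
        ((size (supp_weights w (I j)) * Delta j)%:R <=
           3 * 10 ^+ 8 * log2 (2 * n%:R : R) ^+ 3 * (max_weight w)%:R ^+ 2)%R].
Proof.
(* The time is linear, so the logarithm gets exponent 0. The 8 comes from
   [2 * L.+1 ^ 2 <= 8 * L ^ 2] for [L >= 1], where [L] is the integer part of [log2 (2 * n)]. *)
exists partition_algo, 21, 400, 0, 8 => R n w p W n0 w0 hratio.
have ratio (i j : 'I_n) : i < j -> p j * w i < p i * w j.
  by move=> ij; apply: ratio_nat (hratio _ _ ij); apply: w0.
pose t := prefix_length w W; pose wt := array_of w.
have tn : t <= n by apply: prefix_length_le.
have [T [s [hexec hT [[r0 r2 r3 r5 r7] a0 a4 _ [a2 a3]]]]] :=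
  @runs_scan_classify n w p W n0 w0 300 1000 isT isT.
pose k := size (firsts n t wt n).
have cls (i : 'I_n) : class n t wt (item t i) \in classes n t wt n.
  by rewrite mem_classes map_f // mem_iota item_lt.
have arr2 (i : 'I_n) : arr s 2 i = index (class n t wt (item t i)) (classes n t wt n).
  by rewrite -a2 ?item_lt // itemK.
have arr2k (i : 'I_n) : arr s 2 i < k by rewrite arr2 /k -(size_classes n t wt) index_mem.
pose f (i : 'I_n) := Ordinal (arr2k i).
have first_n (j : 'I_k) : nth 0 (firsts n t wt n) j \in firsts n t wt n by rewrite mem_nth.
have fj (j : 'I_k) : [/\ nth 0 (firsts n t wt n) j < n &
    first n t wt (nth 0 (firsts n t wt n) j)].
  by have := first_n j; rewrite mem_filter mem_iota leq0n add0n => /andP[].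
(* Parts are numbered in the order in which their classes first appear, without repetition, so equal
   numbers mean equal classes. *)
have fE (i : 'I_n) (j : 'I_k) : (f i == j) =
    (class n t wt (item t i) == class n t wt (nth 0 (firsts n t wt n) j)).
  rewrite -val_eqE /= arr2 -(nth_map 0 0) //; apply/eqP/eqP => [<-|->].
    by rewrite nth_index.
  by rewrite index_uniq ?uniq_classes ?size_classes.
pose I (j : 'I_k) := [set i : 'I_n | f i == j].
exists T, s, k, I, (fun j => arr s 3 j); split.
- exact: hexec.
- by rewrite expr0 mulr1 -natrM ler_nat.
- by split=> // i j; rewrite inE -val_eqE.
- apply: partition_fibers => j; have [jn _] := fj j.
  by exists (Ordinal (item_lt tn jn)); apply/eqP; rewrite fE /= itemK.
have L0 : 0 < trunc_log 2 (2 * n) by rewrite -bitlenE //; case: (n) n0.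
have logL := trunc_log_le_log2 R n0.
split.
  apply: (@le_trans _ _ ((8 * trunc_log 2 (2 * n) ^ 2)%N%:R : R)%R).
    rewrite ler_nat; apply: leq_trans (size_firsts_bound t wt n0) _.
    by rewrite bitlenE // -mulnn; move: L0; clear; nia.
  rewrite natrM natrX ler_wpM2l ?ler0n // lerXn2r ?nnegrE ?ler0n //.
  exact: le_trans logL.
move=> j; have [jn jf] := fj j.
have cE := bound_numeratorE w 300 1000 n0.
have IE : I j = [set i : 'I_n |
    class n t wt (item t i) == class n t wt (nth 0 (firsts n t wt n) j)].
  by apply/setP=> i; rewrite !inE fE.
split=> [x optx|]; rewrite a3 // IE.
  exact: (part_proximity n0 w0 ratio cE jn jf optx).
have h := part_supp_bound w W (bound_numerator w 300 1000) jn.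
apply: (@le_trans _ _ ((300 * (1000 * (1000 * (trunc_log 2 (2 * n) ^ 3 *
  max_weight w ^ 2))))%N%:R : R)%R).
  by rewrite ler_nat -cE.
rewrite natrM natrM natrM natrM !natrX.
have -> : (300%:R * (1000%:R * (1000%:R * ((trunc_log 2 (2 * n))%:R ^+ 3 *
    (max_weight w)%:R ^+ 2))) = 3 * 10 ^+ 8 * (trunc_log 2 (2 * n))%:R ^+ 3 *
    (max_weight w)%:R ^+ 2 :> R)%R by ring.
apply: ler_wpM2r; first by rewrite exprn_ge0 // ler0n.
apply: ler_wpM2l; first by rewrite mulr_ge0 ?exprn_ge0 ?ler0n.
by apply: lerXn2r; rewrite ?nnegrE ?ler0n // (le_trans _ logL) ?ler0n.
Qed.
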